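(* Consider the problem $\min_{x\in\mathcal X}\varphi(x)$ with $\varphi(x)=F(f(x),x)$ and the STORM version of the Hybrid Momentum Stochastic Frank--Wolfe algorithm with Taylor function tracker, as described in the context. Suppose: (1) $\mathcal X\subset\mathbb R^d$ is convex and compact with diameter $D_{\mathcal X}<\infty$; (2) $F:\mathbb R^n\times\mathcal X\to\mathbb R$ is $L_F$-Lipschitz in its first argument $u$; is monotone non-decreasing in $u$ ($u_1\le u_2$ componentwise implies $F(u_1,x)\le F(u_2,x)$); and is subhomogeneous in $u$ ($F(\gamma u,x)\le\gamma F(u,x)$ for all $\gamma\ge1$); (3) $f:\mathcal X\to\mathbb R^n$ has $L$-Lipschitz Jacobian: $\|\nabla f(x)-\nabla f(y)\|_{\mathrm{op}}\le L\|x-y\|$ for all $x,y\in\mathcal X$; (4) there are $r\in(1,2]$ and $\sigma_f,\sigma_g\ge0$ such that for every $x\in\mathcal X$ the oracle outputs $\tilde f(x;\xi)$, $\nabla\tilde f(x;\xi)$ are unbiased estimates of $f(x)$, $\nabla f(x)$ with $\mathbb E_\xi\|\tilde f(x;\xi)-f(x)\|^r\le\sigma_f^r$ and $\mathbb E_\xi\|\nabla\tilde f(x;\xi)-\nabla f(x)\|^r\le\sigma_g^r$; (5) ($r$-average smoothness) there is $\bar L>0$ with $\mathbb E_\xi\|\nabla\tilde f(x;\xi)-\nabla\tilde f(y;\xi)\|^r\le\bar L^r\|x-y\|^r$ for all $x,y\in\mathcal X$. With the constant schedule $\gamma=\beta=\rho=K^{-r/(2r-1)}$, $$\min_{1\le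 k\le K}\mathbb E[\hat\Delta_k]=\mathcal O\big(K^{-(r-1)/(2r-1)}\big),$$ where the $\mathcal O(\cdot)$ is as $K\to\infty$ with a constant independent of $K$. In particular, at $r=2$ the rate is $\mathcal O(K^{-1/3})$.
   Context: Norms: $\|\cdot\|$ is the Euclidean norm on vectors and the Frobenius norm on matrices; $\|\cdot\|_{\mathrm{op}}$ is the operator norm; $D_{\mathcal X}=\max_{x,y\in\mathcal X}\|x-y\|$. Problem: $f:\mathcal X\to\mathbb R^n$ is differentiable with Jacobian $\nabla f(x)\in\mathbb R^{n\times d}$, $f(x)=\mathbb E_\xi[\tilde f(x;\xi)]$, and $\varphi(x)=F(f(x),x)$. All minima over $\mathcal X$ appearing are assumed attained. The generalized Frank--Wolfe gap at $y\in\mathcal X$ is $\hat\Delta(y)=\varphi(y)-\min_{x\in\mathcal X}F(f(y)+\nabla f(y)(x-y),x)$, and $\hat\Delta_k:=\hat\Delta(y_k)$. Algorithm (STORM version), with constant parameters $\gamma,\beta,\rho\in(0,1]$ and deterministic $y_0\in\mathcal X$. The samples $\xi_0,\xi_1,\dots$ are independent draws from the oracle distribution. Initialize $z_0=\tilde f(y_0;\xi_0)\in\mathbb R^n$, $V_0=\nabla\tilde f(y_0;\xi_0)\in\mathbb R^{n\times d}$. For every $k\ge1$, at the current point $y_k$: - STORM Jacobian tracker (the same sample $\xi_k$ is used at $y_k$ and $y_{k-1}$): $V_k=\nabla\tilde f(y_k;\xi_k)+(1-\beta)[V_{k-1}-\nabla\tilde f(y_{k-1};\xi_k)]$; - Taylor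 function tracker (Variant II): $z_k=(1-\rho)[z_{k-1}+V_k(y_k-y_{k-1})]+\rho\tilde f(y_k;\xi_k)$. For every $k\ge0$: $x_{k+1}\in\arg\min_{x\in\mathcal X}F(z_k+V_k(x-y_k),x)$ and $y_{k+1}=(1-\gamma)y_k+\gamma x_{k+1}$.
   Formalization: The formal theorem additionally assumes that F is jointly convex on R^n × X; without this the claim fails, e.g. for X=[0,1], f=0, y_0=1, F(u,x)=1 if x≠0 and F(u,0)=0, where the gap equals 1 at every iterate. *)

(* Defs.v *)
(* MathComp-Analysis; vectors are columns, so that a Jacobian acts by [*m] on
   the left.  Maps whose mathematical domain is a set X of 'cV[R]_d are total
   functions, and are only ever constrained on X. *)
From HB Require Import structures.
From mathcomp Require Import all_boot all_order all_algebra.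
From mathcomp Require Import all_classical all_reals all_analysis.
Import Order.TTheory GRing.Theory Num.Theory.
Import numFieldNormedType.Exports.

Set Implicit Arguments.
Unset Strict Implicit.
Unset Printing Implicit Defensive.

Local Open Scope classical_set_scope.
Local Open Scope ring_scope.

(* Euclidean norm of a vector, Frobenius norm of a matrix.  (The library norm
   [`|A|] on matrices is the max-norm.) *)
Definition enorm {R : realType} {m n : nat} (A : 'M[R]_(m, n)) : R :=
  Num.sqrt (\sum_(i < m) \sum_(j < n) A i j ^+ 2).

Definition opnorm {R : realType} {m n : nat} (A : 'M[R]_(m, n)) : R :=
  sup [set enorm (A *m v) | v in [set v : 'cV[R]_n | enorm v <= 1]].

(* Frechet differentiability relative to X, since X may have empty interior;
   the Jacobian is then a datum, not a function of f. *)
Definition has_jacobian_on {R : realType} {d n : nat} (X : set 'cV[R]_d)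
    (f : 'cV[R]_d -> 'cV[R]_n) (Jf : 'cV[R]_d -> 'M[R]_(n, d)) : Prop :=
  forall x, X x -> forall e : R, 0 < e ->
    \forall y \near within X (nbhs x),
      enorm (f y - f x - Jf x *m (y - x)) <= e * enorm (y - x).

Definition is_argmin {R : realType} {U : Type} (X : set U) (g : U -> R)
    (x : U) : Prop :=
  X x /\ forall x', X x' -> g x <= g x'.

(* The minimum of g over X whenever it is attained. *)
Definition minimum {R : realType} {U : Type} (X : set U) (g : U -> R) : R :=
  inf [set g x | x in X].

Definition linearized {R : realType} {d n : nat}
    (F : 'cV[R]_n -> 'cV[R]_d -> R) (u : 'cV[R]_n) (J : 'M[R]_(n, d))
    (y x : 'cV[R]_d) : R :=
  F (u + J *m (x - y)) x.

Definition fw_gap {R : realType} {d n : nat} (X : set 'cV[R]_d)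
    (F : 'cV[R]_n -> 'cV[R]_d -> R)
    (f : 'cV[R]_d -> 'cV[R]_n) (Jf : 'cV[R]_d -> 'M[R]_(n, d))
    (y : 'cV[R]_d) : R :=
  F (f y) y - minimum X (linearized F (f y) (Jf y) y).

(* R^d with its Borel sigma-algebra, generated by the coordinates. *)
Definition borel_cV (R : realType) (d : nat) :=
  g_sigma_algebraType (\bigcup_(i : 'I_d)
    preimage_set_system setT (fun x : 'cV[R]_d => x i 0) measurable).

(* Joint measurability of an oracle (x, s) |-> h x s on X * Xi, without which
   the oracle evaluated at a random point need not be a random variable. *)
Definition measurable_oracle {R : realType} {d m n : nat} {dX : measure_display}
    {Xi : measurableType dX} (X : set 'cV[R]_d)
    (h : 'cV[R]_d -> Xi -> 'M[R]_(m, n)) : Prop :=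
  forall i j, measurable_fun [set p : borel_cV R d * Xi | X p.1]
    (fun p => h p.1 p.2 i j).

Definition unbiased_on {R : realType} {d m n : nat} {dX : measure_display}
    {Xi : measurableType dX} (mu : probability Xi R) (X : set 'cV[R]_d)
    (h : 'cV[R]_d -> Xi -> 'M[R]_(m, n)) (g : 'cV[R]_d -> 'M[R]_(m, n)) : Prop :=
  forall x, X x -> forall i j, ('E_mu[fun s => h x s i j] = (g x i j)%:E)%E.

Definition iid_samples {R : realType} {dT dX : measure_display}
    {T : measurableType dT} {Xi : measurableType dX} (P : probability T R)
    (mu : probability Xi R) (xi : nat -> T -> Xi) : Prop :=
  [/\ forall k, measurable_fun setT (xi k),
      forall k A, measurable A -> P (xi k @^-1` A) = mu A
    & forall (s : seq nat) (A : nat -> set Xi), uniq s ->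
        (forall k, measurable (A k)) ->
        (P (\big[setI/setT]_(k <- s) (xi k @^-1` A k)) =
           \big[*%E/1%E]_(k <- s) P (xi k @^-1` A k))%E].

(* The choice of a minimizer x_{k+1} among several may depend on the samples
   xi_0, ..., xi_k and on extra randomness, but not on the later samples: it is
   G_k-measurable, for a filtration G to which xi is adapted and such that
   xi_{k+1} is independent of G_k. *)
Definition nonanticipating {R : realType} {dT dX : measure_display}
    {T : measurableType dT} {Xi : measurableType dX} {d : nat}
    (P : probability T R) (xi : nat -> T -> Xi) (G : nat -> set (set T))
    (x : nat -> T -> 'cV[R]_d) : Prop :=
  [/\ forall k, [/\ sigma_algebra setT (G k), G k `<=` measurable
                  & G k `<=` G k.+1],
      forall k A, measurable A -> G k (xi k @^-1` A),
      forall k A B, G k A -> measurable B ->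
        (P (A `&` xi k.+1 @^-1` B) = P A * P (xi k.+1 @^-1` B))%E
    & forall k i (B : set R), measurable B ->
        G k [set w | B (x k.+1 w i 0)]].

(* The STORM method with Taylor function tracker, run on the probability space
   (T, P).  The value x 0 is irrelevant. *)
Record storm_run {R : realType} {dT dX : measure_display}
    {T : measurableType dT} {Xi : measurableType dX} {d n : nat}
    (P : probability T R) (mu : probability Xi R) (X : set 'cV[R]_d)
    (F : 'cV[R]_n -> 'cV[R]_d -> R)
    (ft : 'cV[R]_d -> Xi -> 'cV[R]_n) (gt : 'cV[R]_d -> Xi -> 'M[R]_(n, d))
    (gamma beta rho : R) (y0 : 'cV[R]_d)
    (xi : nat -> T -> Xi) (G : nat -> set (set T))
    (x y : nat -> T -> 'cV[R]_d) (z : nat -> T -> 'cV[R]_n)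
    (V : nat -> T -> 'M[R]_(n, d)) : Prop := StormRun {
  run_samples : iid_samples P mu xi ;
  run_nonanticipating : nonanticipating P xi G x ;
  run_y0 : forall w, y 0%N w = y0 ;
  run_z0 : forall w, z 0%N w = ft y0 (xi 0%N w) ;
  run_V0 : forall w, V 0%N w = gt y0 (xi 0%N w) ;
  run_V : forall k w, V k.+1 w =
    gt (y k.+1 w) (xi k.+1 w)
    + (1 - beta) *: (V k w - gt (y k w) (xi k.+1 w)) ;
  run_z : forall k w, z k.+1 w =
    (1 - rho) *: (z k w + V k.+1 w *m (y k.+1 w - y k w))
    + rho *: ft (y k.+1 w) (xi k.+1 w) ;
  run_x : forall k w,
    is_argmin X (linearized F (z k w) (V k w) (y k w)) (x k.+1 w) ;
  run_y : forall k w, y k.+1 w = (1 - gamma) *: y k w + gamma *: x k.+1 w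
}.

(* min_(1 <= k <= K) E[gap (y_k)] = O(K^e) as K -> oo for the parameters
   gamma = beta = rho = K^(-r/(2r-1)).  The method depends on K through its
   parameters, so the constant is required to be uniform over all runs; it
   depends on the data of the problem only.  Measurability of the gap along the
   iterates is what makes the expectation meaningful; being nonnegative, the
   gap needs no integrability assumption. *)
Definition storm_gap_rate {R : realType} {dX : measure_display}
    {Xi : measurableType dX} {d n : nat} (mu : probability Xi R)
    (X : set 'cV[R]_d) (F : 'cV[R]_n -> 'cV[R]_d -> R)
    (f : 'cV[R]_d -> 'cV[R]_n) (Jf : 'cV[R]_d -> 'M[R]_(n, d))
    (ft : 'cV[R]_d -> Xi -> 'cV[R]_n) (gt : 'cV[R]_d -> Xi -> 'M[R]_(n, d))
    (y0 : 'cV[R]_d) (r e : R) : Prop :=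
  exists C : R, \forall K \near \oo,
    let a := K%:R `^ (- r / (2 * r - 1)) in
    forall (dT : measure_display) (T : measurableType dT) (P : probability T R)
      (xi : nat -> T -> Xi) (G : nat -> set (set T))
      (x y : nat -> T -> 'cV[R]_d) (z : nat -> T -> 'cV[R]_n)
      (V : nat -> T -> 'M[R]_(n, d)),
    storm_run P mu X F ft gt a a a y0 xi G x y z V ->
    (forall k, measurable_fun setT (fun w => fw_gap X F f Jf (y k w))) ->
    (`| \big[Order.min/+oo]_(1 <= k < K.+1) 'E_P[fun w => fw_gap X F f Jf (y k w)] |
       <= (C * K%:R `^ e)%:E)%E.

(* Main.v *)
(* Joint convexity of F gives a one-step descent: a times the gap at y_k is at
   most the decrease of F(f(y), y), up to a times the errors of the two trackers
   and O(a^2).  Each tracking error splits into a part that contracts by 1 - a,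
   plus, entry by entry, a martingale S_{k+1} = (1 - a) S_k + M_{k+1} whose
   increments have r-th moment O(a^r): for the Jacobian this is what the STORM
   correction buys, since y_k moves by O(a) only.  By the von Bahr-Esseen
   inequality E|S_k|^r = O(a^(r-1)), that is E|S_k| = O(tau) with
   tau = a^((r-1)/r) = K^(-(r-1)/(2r-1)).  Summing over k <= K and dividing by
   a K = 1 / tau gives the rate. *)
Require Import Defs.
From HB Require Import structures.
From mathcomp Require Import all_boot all_order all_algebra.
From mathcomp Require Import all_classical all_reals all_analysis.
From mathcomp Require Import finmap measurable_realfun ring lra.
Import Order.TTheory GRing.Theory Num.Theory.
Import numFieldNormedType.Exports.

Set Implicit Arguments.
Unset Strict Implicit.
Unset Printing Implicit Defensive.

Local Open Scope classical_set_scope.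
Local Open Scope ring_scope.

(** Neither tracker is conditionally unbiased in general, so the noise is isolated before any
    expectation is taken: on a fixed sample path, subtracting the martingale from a tracking error
    leaves a remainder with a deterministic recursion. Expectations are then needed only for the
    martingales and for the errors at time 0. The latter are of order 1, but a telescoped
    contraction counts them once. The function tracker moves along V_{k+1} and so inherits at each
    step at most a D times the Jacobian error; a contraction by 1 - a divides this by a in the sum,
    so the coupling only changes constants. Moments of order r < 2 rule out variance identities. An
    expansion of |a + b|^r whose linear term has conditional mean 0 replaces the square, and E|S|^r
    is turned into E|S| by |s| <= tau + tau^(1-r) |s|^r, which integrates term by term. The step
    size solves a K tau = 1 with tau = a^((r-1)/r); since a <= tau, the curvature terms, of total
    order K a^2, stay bounded. *)

(** * Elementary inequalities for real powers *)

(** Bernoulli's inequality for exponents in [0, 1], from the convexity of [expR] between ln (1 + t)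
    and 0; the logarithm forces t = -1 to be treated apart. *)
Lemma powR1D_le {R : realType} (t p : R) : -1 <= t -> 0 <= p -> p <= 1 ->
  (1 + t) `^ p <= 1 + p * t.
Proof.
move=> t1 p0 p1; have [->|pN0] := eqVneq p 0; first by rewrite powRr0 mul0r addr0.
have [t1'|t1'] := eqVneq t (-1).
  by rewrite t1' subrr powR0// mulrN1 subr_ge0.
have t_gt : 0 < 1 + t by rewrite -ltrBlDl sub0r lt_neqAle eq_sym t1'.
have := convex_expR (Itv01 p0 p1) (ln (1 + t) : R^o) (0 : R^o).
rewrite !convRE/= expR0 lnK// mulr0 addr0 mulr1 /unstable.onem /powR gt_eqF//.
by move=> /le_trans; apply; lra.
Qed.

(** The signed power sign(a) |a|^p. The derivative of |a|^r is r times [spow (r - 1) a]; the product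
    form makes the value at 0 equal to 0 for every p. *)
Definition spow {R : realType} (p a : R) : R := a * `|a| `^ (p - 1).

Lemma norm_spow {R : realType} (p a : R) : 0 < p -> `|spow p a| = `|a| `^ p.
Proof.
by move=> p0; rewrite /spow normrM (ger0_norm (powR_ge0 _ _)) mulr_powRB1.
Qed.

(* The analogue of the expansion of a square that drives the von Bahr-Esseen
   inequality. *)
Lemma powR_normD_le {R : realType} (r a b : R) : 1 < r -> r <= 2 ->
  `|a + b| `^ r <= `|a| `^ r + r * (spow (r - 1) a * b) + 6 * `|b| `^ r.
Proof.
move=> r1 r2; have r0 : 0 < r by lra.
wlog a0 : a b / 0 <= a.
  move=> H; have [/H//|a0] := leP 0 a.
  have := H (- a) (- b); rewrite oppr_ge0 => /(_ (ltW a0)).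
  by rewrite /spow -opprD !normrN !(mulNr, mulrN) opprK.
have [->|aN0] := eqVneq a 0.
  rewrite /spow !mul0r mulr0 normr0 powR0 ?gt_eqF// !add0r.
  have := powR_ge0 `|b| r; lra.
have a_gt0 : 0 < a by rewrite lt_neqAle eq_sym aN0.
rewrite /spow (ger0_norm a0) mulr_powRB1 ?subr_gt0//.
have [ba|ab] := leP `|b| a.
  pose t := b / a; have bE : b = a * t by rewrite /t mulrC divfK.
  have t1 : `|t| <= 1 by rewrite /t normf_div (ger0_norm a0) ler_pdivrMr// mul1r.
  have /andP[tN1 tle1] : -1 <= t <= 1 by rewrite -ler_norml.
  have -> : a + b = a * (1 + t) by rewrite bE; ring.
  rewrite normrM (ger0_norm a0) [in `|1 + t|]ger0_norm; last by lra.
  rewrite bE normrM (ger0_norm a0) !powRM//; last by lra.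
  have -> : a `^ (r - 1) * (a * t) = a `^ r * t.
    by rewrite mulrA [_ * a]mulrC mulr_powRB1.
  (* One factor 1 + t is split off and Bernoulli is applied to the exponent r - 1. The product is 1
     + r t + (r - 1) t^2, and t^2 <= |t|^r because |t| <= 1 and r <= 2. *)
  have h : (1 + t) `^ r <= 1 + r * t + 6 * `|t| `^ r.
    rewrite -mulr_powRB1//; last by lra.
    have h1 : (1 + t) * (1 + t) `^ (r - 1) <= (1 + t) * (1 + (r - 1) * t).
      by rewrite ler_wpM2l ?powR1D_le//; lra.
    apply: (le_trans h1).
    have h2 : t ^+ 2 <= `|t| `^ r.
      have [->|tN0] := eqVneq t 0; first by rewrite expr0n/= powR_ge0.
      rewrite -real_normK ?num_real// -powR_mulrn// ger_powR//.
      by rewrite normr_gt0 tN0.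
    have h3 := powR_ge0 `|t| r.
    have h4 : 0 <= (2 - r) * t ^+ 2 by rewrite mulr_ge0 ?sqr_ge0; lra.
    rewrite expr2 in h2 h4; nra.
  have := ler_wpM2l (powR_ge0 a r) h; rewrite !mulrDr; lra.
(* The constant 6 arises where b dominates: 2^r <= 4 for the power of the sum, plus r <= 2 for the
   linear term, which may be negative. *)
have h1 : `|a + b| `^ r <= 4 * `|b| `^ r.
  have h : `|a + b| <= 2 * `|b|.
    by rewrite (le_trans (ler_normD _ _))// (ger0_norm a0); lra.
  apply: (@le_trans _ _ ((2 * `|b|) `^ r)).
    by rewrite ge0_ler_powR ?nnegrE// ?mulr_ge0// ltW.
  rewrite powRM// ler_wpM2r ?powR_ge0//.
  rewrite (_ : 4 = 2 `^ 2%:R) ?ler_powR// ?powR_mulrn//; lra.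
have h2 : `|a `^ (r - 1) * b| <= `|b| `^ r.
  rewrite normrM (ger0_norm (powR_ge0 _ _)) -(@mulr_powRB1 _ `|b|)//.
  rewrite mulrC ler_wpM2l//.
  by rewrite ge0_ler_powR ?nnegrE//; lra.
have h3 := powR_ge0 a r.
have h4 := powR_ge0 `|b| r.
move: h2; rewrite ler_norml => /andP[h2 _].
have h5 : - (2 * `|b| `^ r) <= r * (a `^ (r - 1) * b) by nra.
lra.
Qed.

(** The sum is at most twice the larger term, and 2^r <= 4. *)
Lemma powR_normD_le4 {R : realType} (r a b : R) : 1 < r -> r <= 2 ->
  `|a + b| `^ r <= 4 * (`|a| `^ r + `|b| `^ r).
Proof.
move=> r1 r2; have r0 : 0 < r by lra.
wlog ab : a b / `|a| <= `|b|.
  move=> H; have [/H//|/ltW/H] := leP `|a| `|b|; by rewrite addrC [in X in _ <= X]addrC.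
have h : `|a + b| <= 2 * `|b| by rewrite (le_trans (ler_normD _ _))//; lra.
apply: (@le_trans _ _ ((2 * `|b|) `^ r)).
  by rewrite ge0_ler_powR ?nnegrE// ?mulr_ge0// ltW.
rewrite powRM//; have h3 := powR_ge0 `|a| r; have h4 := powR_ge0 `|b| r.
have h5 : (2 : R) `^ r <= 4.
  by rewrite (_ : 4 = 2 `^ 2%:R) ?ler_powR// ?powR_mulrn//; lra.
nra.
Qed.

(** Beyond the threshold tau the factor (|a| / tau)^(r-1) exceeds 1. This plays the part of Hölder's
    inequality: when the r-th moment is of order tau^r, both terms are of order tau. *)
Lemma norm_le_powR {R : realType} (r tau a : R) : 1 < r -> 0 < tau ->
  `|a| <= tau + tau `^ (1 - r) * `|a| `^ r.
Proof.
move=> r1 tau0; have [h|h] := leP `|a| tau.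
  by rewrite (le_trans h)// lerDl mulr_ge0 ?powR_ge0.
rewrite -[leLHS]add0r lerD ?(ltW tau0)//.
have a0 : 0 < `|a| by exact: lt_trans h.
rewrite -(@mulr_powRB1 _ `|a| r)//; last by lra.
rewrite mulrCA -[leLHS]mulr1 ler_wpM2l//.
rewrite -opprB powRN mulrC ler_pdivlMr ?powR_gt0// mul1r.
by rewrite ge0_ler_powR ?nnegrE ?(ltW h) ?(ltW tau0)//; lra.
Qed.

(** A crude form of Young's inequality, by comparing |a| with |b|; it makes the linear term of the
    expansion integrable. *)
Lemma spow_mul_le {R : realType} (r a b : R) : 1 < r ->
  `|spow (r - 1) a * b| <= `|a| `^ r + `|b| `^ r.
Proof.
move=> r1; rewrite normrM norm_spow ?subr_gt0//.
have h3 := powR_ge0 `|a| r; have h4 := powR_ge0 `|b| r.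
have [h|h] := leP `|a| `|b|.
  have : `|a| `^ (r - 1) * `|b| <= `|b| `^ r.
    rewrite -(@mulr_powRB1 _ `|b| r) ?(lt_trans _ r1)// mulrC ler_wpM2l//.
    by rewrite ge0_ler_powR ?nnegrE//; lra.
  lra.
have : `|a| `^ (r - 1) * `|b| <= `|a| `^ r.
  by rewrite -(@mulr_powRB1 _ `|a| r) ?(lt_trans _ r1)// mulrC ler_wpM2r ?powR_ge0// ltW.
lra.
Qed.

Lemma measurable_spow {R : realType} (p : R) : measurable_fun setT (@spow R p).
Proof.
apply: measurable_funM.
  exact: measurable_id.
exact: (measurableT_comp (measurable_powR (p - 1)) (@normr_measurable R setT)).
Qed.

(** * Entrywise, Euclidean and operator norms *)

Section l1norm.
Context {R : realType}.

(* All norms being equivalent, the argument is run with the entrywise l1 norm,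
   for which the triangle inequality and submultiplicativity are immediate. *)
Definition l1norm {m n : nat} (A : 'M[R]_(m, n)) : R :=
  \sum_(i < m) \sum_(j < n) `|A i j|.

Lemma l1norm_ge0 m n (A : 'M[R]_(m, n)) : 0 <= l1norm A.
Proof. by apply: sumr_ge0 => i _; apply: sumr_ge0. Qed.

Lemma l1normD m n (A B : 'M[R]_(m, n)) : l1norm (A + B) <= l1norm A + l1norm B.
Proof.
rewrite /l1norm -big_split/=; apply: ler_sum => i _.
rewrite -big_split/=; apply: ler_sum => j _; rewrite mxE; exact: ler_normD.
Qed.

Lemma l1normZ m n c (A : 'M[R]_(m, n)) : l1norm (c *: A) = `|c| * l1norm A.
Proof.
rewrite /l1norm mulr_sumr; apply: eq_bigr => i _.
by rewrite mulr_sumr; apply: eq_bigr => j _; rewrite mxE normrM.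
Qed.

Lemma l1normN m n (A : 'M[R]_(m, n)) : l1norm (- A) = l1norm A.
Proof. by rewrite -scaleN1r l1normZ normrN1 mul1r. Qed.

Lemma l1normB m n (A B : 'M[R]_(m, n)) : l1norm (A - B) <= l1norm A + l1norm B.
Proof. by rewrite (le_trans (l1normD _ _))// l1normN. Qed.

Lemma entry_le_l1norm m n (A : 'M[R]_(m, n)) i j : `|A i j| <= l1norm A.
Proof.
rewrite /l1norm (bigD1 i)//= (bigD1 j)//= -addrA lerDl addr_ge0//.
  exact: sumr_ge0.
by apply: sumr_ge0 => k _; exact: sumr_ge0.
Qed.

Lemma l1norm_mul m n p (A : 'M[R]_(m, n)) (B : 'M[R]_(n, p)) :
  l1norm (A *m B) <= l1norm A * l1norm B.
Proof.
rewrite {1 2}/l1norm mulr_suml; apply: ler_sum => i _.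
rewrite mulr_suml.
apply: (@le_trans _ _ (\sum_j \sum_k `|A i k| * `|B k j|)).
  apply: ler_sum => j _; rewrite mxE.
  apply: (le_trans (ler_norm_sum _ _ _)); apply: ler_sum => k _.
  by rewrite normrM.
rewrite exchange_big/=; apply: ler_sum => k _.
rewrite -mulr_sumr ler_wpM2l//.
by rewrite /l1norm [leRHS](bigD1 k)//= lerDl; apply: sumr_ge0 => l _; exact: sumr_ge0.
Qed.

Lemma sum_sqr_le_sqr_sum (I : Type) (s : seq I) (a : I -> R) :
  (forall i, 0 <= a i) -> \sum_(i <- s) a i ^+ 2 <= (\sum_(i <- s) a i) ^+ 2.
Proof.
move=> a0.
suff [] : \sum_(i <- s) a i ^+ 2 <= (\sum_(i <- s) a i) ^+ 2 /\ 0 <= \sum_(i <- s) a i by [].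
apply: (big_rec2 (fun x y => x <= y ^+ 2 /\ 0 <= y)); first by rewrite expr0n.
move=> i y1 y2 _ [h1 h2]; split; last by rewrite addr_ge0.
have := a0 i; rewrite !expr2 in h1 *; nra.
Qed.

Lemma enorm_ge0 m n (A : 'M[R]_(m, n)) : 0 <= enorm A.
Proof. exact: sqrtr_ge0. Qed.

Lemma enorm_le_l1norm m n (A : 'M[R]_(m, n)) : enorm A <= l1norm A.
Proof.
rewrite -(ger0_norm (l1norm_ge0 A)) -sqrtr_sqr ler_wsqrtr//.
rewrite /l1norm !pair_big/=.
under eq_bigr do rewrite -real_normK ?num_real//.
exact: sum_sqr_le_sqr_sum.
Qed.

Lemma entry_le_enorm m n (A : 'M[R]_(m, n)) i j : `|A i j| <= enorm A.
Proof.
rewrite -sqrtr_sqr ler_wsqrtr// (bigD1 i)//= (bigD1 j)//= -addrA lerDl addr_ge0//.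
  by apply: sumr_ge0 => k _; exact: sqr_ge0.
by apply: sumr_ge0 => k _; apply: sumr_ge0 => l _; exact: sqr_ge0.
Qed.

Lemma l1norm_le_entries m n (A : 'M[R]_(m, n)) c :
  (forall i j, `|A i j| <= c) -> l1norm A <= (m * n)%:R * c.
Proof.
move=> Ac; apply: (@le_trans _ _ (\sum_(i < m) \sum_(j < n) c)).
  by apply: ler_sum => i _; apply: ler_sum.
rewrite (eq_bigr (fun=> c *+ n)); last by move=> i _; rewrite sumr_const card_ord.
by rewrite sumr_const card_ord -mulrnA mulnC mulr_natl.
Qed.

Lemma l1norm_le_enorm m n (A : 'M[R]_(m, n)) : l1norm A <= (m * n)%:R * enorm A.
Proof. by apply: l1norm_le_entries => i j; exact: entry_le_enorm. Qed.

Lemma entry_le_opnorm m n (A : 'M[R]_(m, n)) i j : `|A i j| <= opnorm A.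
Proof.
pose e : 'cV[R]_n := delta_mx j 0.
have e1 : enorm e <= 1.
  rewrite (le_trans (enorm_le_l1norm _))// /l1norm (bigD1 j)//= big_ord1 big1.
    by rewrite mxE !eqxx normr1 addr0.
  by move=> k kj; rewrite big_ord1 mxE (negPf kj) normr0.
apply: (@le_trans _ _ (enorm (A *m e))).
  rewrite (_ : A i j = (A *m e) i 0) ?entry_le_enorm//.
  by rewrite -colE mxE.
apply: ub_le_sup; last by exists e.
(* A [sup] dominates its set only if that set is bounded above; the bound comes from
   submultiplicativity and from comparing the two norms on the unit ball. *)
exists (l1norm A * (n * 1)%:R) => _ [v /= v1 <-].
rewrite (le_trans (enorm_le_l1norm _))// (le_trans (l1norm_mul _ _))//.
rewrite ler_wpM2l ?l1norm_ge0// (le_trans (l1norm_le_enorm _))//.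
by rewrite ler_piMr.
Qed.

Lemma entryBB m n (A B C : 'M[R]_(m, n)) i j :
  (A - B - C) i j = A i j - B i j - C i j.
Proof. by rewrite !mxE. Qed.

Lemma entryZ m n c (A : 'M[R]_(m, n)) i j : (c *: A) i j = c * A i j.
Proof. by rewrite mxE. Qed.

End l1norm.

(** * Independence as a product law *)

Section joint_law.
Context {R : realType} {d1 d2 d3 : measure_display} {T : measurableType d1}
  {T' : measurableType d2} {S : measurableType d3}.
Variables (P : probability T R) (mu : probability S R) (p : {mfun T >-> T'})
  (xi : {mfun T >-> S}).
Hypothesis indep : forall A B, measurable A -> measurable B ->
  (P (p @^-1` A `&` xi @^-1` B) = P (p @^-1` A) * mu B)%E.

Let h w := (p w, xi w).

Let mh : measurable_fun setT h.
Proof. exact: measurable_fun_pair. Qed.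

Let hm : {mfun T >-> (T' * S)%type} := mfun_Sub (mem_set mh).

(** [indep] says that the two measures agree on rectangles, which determines the product measure;
    its case A = [setT] makes [mu] the law of [xi]. *)
Lemma joint_law_product (g : T' * S -> \bar R) :
  (\int[distribution P p \x mu]_z g z = \int[distribution P hm]_z g z)%E.
Proof.
apply: eq_measure_integral => A mA _.
exact: product_measure_unique.
Qed.

Lemma ge0_integral_joint (g : T' * S -> \bar R) : measurable_fun setT g ->
  (forall z, (0 <= g z)%E) ->
  (\int[P]_w g (p w, xi w) = \int[P]_w \int[mu]_s g (p w, s))%E.
Proof.
move=> mg g0.
rewrite -[LHS](ge0_integral_distribution hm mg g0) -joint_law_product.
rewrite fubini_tonelli1// ge0_integral_distribution//.
- exact: measurable_fun_fubini_tonelli_F.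
- by move=> y; apply: integral_ge0 => s _; exact: g0.
Qed.

Lemma integral_joint (g : T' * S -> \bar R) : measurable_fun setT g ->
  P.-integrable setT (fun w => g (p w, xi w)) ->
  (\int[P]_w g (p w, xi w) = \int[distribution P p]_a \int[mu]_s g (a, s))%E.
Proof.
move=> mg ig.
rewrite -[LHS](integral_distribution (X := hm) mg ig) -joint_law_product.
rewrite -[LHS]integral12_prod_meas1//.
(* Integrability for the product measure is read off under [P]: Tonelli and the joint law turn the
   iterated integral of |g| into the expectation of |g (p, xi)|. *)
apply/integrable12ltyP => //.
rewrite -[ltLHS](fubini_tonelli1 (abse \o g)).
- rewrite joint_law_product ge0_integral_distribution.
  + by have /integrableP[] := ig.
  + exact: measurableT_comp.
  + by move=> y; exact: abse_ge0.
- exact: measurableT_comp.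
- by move=> y; exact: abse_ge0.
Qed.

End joint_law.

(** * Moments of a sum of two terms *)

Section one_step.
Context {R : realType} {dT : measure_display} {T : measurableType dT}.
Variables (P : probability T R) (r : R).
Hypotheses (r1 : 1 < r) (r2 : r <= 2).
Implicit Types A B : T -> R.

Lemma measurable_norm_powR {dU : measure_display} {U : measurableType dU}
    (A : U -> R) p : measurable_fun setT A ->
  measurable_fun setT (fun w => `|A w| `^ p).
Proof.
move=> mA; apply: (measurableT_comp (measurable_powR p)).
exact: measurableT_comp.
Qed.

Lemma integrable_norm_powR A (a : R) : measurable_fun setT A ->
  (\int[P]_w (`|A w| `^ r)%:E <= a%:E)%E ->
  P.-integrable setT (fun w => (`|A w| `^ r)%:E).
Proof.
move=> mA Aa; apply/integrableP; split.
  by apply/measurable_EFinP; exact: measurable_norm_powR.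
under eq_integral do rewrite gee0_abs ?lee_fin ?powR_ge0//.
by rewrite (le_lt_trans Aa)// ltry.
Qed.

Lemma integrable_spow_mul A B (a b : R) :
  measurable_fun setT A -> measurable_fun setT B ->
  (\int[P]_w (`|A w| `^ r)%:E <= a%:E)%E ->
  (\int[P]_w (`|B w| `^ r)%:E <= b%:E)%E ->
  P.-integrable setT (fun w => (spow (r - 1) (A w) * B w)%:E).
Proof.
move=> mA mB Aa Bb.
have iA := integrable_norm_powR mA Aa; have iB := integrable_norm_powR mB Bb.
have iAB := integrableD measurableT iA iB.
apply: le_integrable iAB => //.
  apply/measurable_EFinP/measurable_funM => //.
  by apply: (measurableT_comp (measurable_spow _)).
move=> w _ /=; rewrite lee_fin (le_trans (spow_mul_le _ _ r1))//.
exact: ler_norm.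
Qed.

(** One step of the von Bahr-Esseen inequality: the pointwise expansion [powR_normD_le] is
    integrated, and the last hypothesis is what the martingale property supplies. *)
Lemma expected_powR_normD A B (a b : R) :
  measurable_fun setT A -> measurable_fun setT B ->
  (\int[P]_w (`|A w| `^ r)%:E <= a%:E)%E ->
  (\int[P]_w (`|B w| `^ r)%:E <= b%:E)%E ->
  (\int[P]_w (spow (r - 1) (A w) * B w)%:E = 0)%E ->
  (\int[P]_w (`|A w + B w| `^ r)%:E <= (a + 6 * b)%:E)%E.
Proof.
move=> mA mB Aa Bb AB0.
have iA := integrable_norm_powR mA Aa; have iB := integrable_norm_powR mB Bb.
have iAB := integrable_spow_mul mA mB Aa Bb.
have irAB := integrableZl measurableT r iAB.
have i6B := integrableZl measurableT 6 iB.
have iD := integrableD measurableT iA irAB.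
have := integralD measurableT iD i6B.
rewrite (integralD measurableT iA irAB) !integralZl// AB0 mule0 adde0 => E.
apply: (@le_trans _ _ (\int[P]_w ((`|A w| `^ r)%:E +
    r%:E * (spow (r - 1) (A w) * B w)%:E + 6%:E * (`|B w| `^ r)%:E)))%E.
  apply: ge0_le_integral => //.
  - apply/measurable_EFinP/measurable_norm_powR; exact: measurable_funD.
  - exact: (measurable_int P (integrableD measurableT iD i6B)).
  - by move=> w _; rewrite -!EFinM -!EFinD lee_fin powR_normD_le.
by rewrite E [(_ + _)%:E]EFinD leeD// EFinM lee_wpmul2l// lee_fin.
Qed.

Lemma expected_norm_le A (a tau : R) : 0 < tau -> measurable_fun setT A ->
  (\int[P]_w (`|A w| `^ r)%:E <= a%:E)%E ->
  (\int[P]_w `|A w|%:E <= (tau + tau `^ (1 - r) * a)%:E)%E.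
Proof.
move=> tau0 mA Aa.
have iA := integrable_norm_powR mA Aa.
have ic : P.-integrable setT (fun=> tau%:E : \bar R).
  exact: finite_measure_integrable_cst.
have iZ := integrableZl measurableT (tau `^ (1 - r)) iA.
have := integralD measurableT ic iZ.
rewrite integralZl// integral_cst//= probability_setT mule1 => E.
apply: (@le_trans _ _ (\int[P]_w (tau%:E + (tau `^ (1 - r))%:E * (`|A w| `^ r)%:E)))%E.
  apply: ge0_le_integral => //.
  - by apply/measurable_EFinP; exact: measurableT_comp.
  - exact: (measurable_int P (integrableD measurableT ic iZ)).
  - by move=> w _; rewrite -!EFinM -!EFinD lee_fin norm_le_powR.
by rewrite E [(_ + _)%:E]EFinD leeD// EFinM lee_wpmul2l// lee_fin powR_ge0.
Qed.

End one_step.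

(** * Conditioning on the past, and leaky martingales *)

Section filtration.
Context {R : realType} {dT dX : measure_display} {T : measurableType dT}
  {Xi : measurableType dX} {d : nat}.
Variables (P : probability T R) (mu : probability Xi R) (xi : nat -> T -> Xi)
  (G : nat -> set (set T)) (x : nat -> T -> 'cV[R]_d).
Hypotheses (samples : iid_samples P mu xi) (nonant : nonanticipating P xi G x).

(** [sub k] is [T] carrying the sigma-algebra [G k], so that adaptedness becomes ordinary
    measurability from this type. *)
Local Notation sub k := (g_sigma_algebraType (G k)).

Lemma sub_measurableE k (A : set T) : measurable (A : set (sub k)) = G k A.
Proof.
have [/(_ k)[sG _ _] _ _ _] := nonant.
by rewrite /measurable/= /g_sigma_algebraType sigma_algebra_id.
Qed.

Lemma sub_measurable_id k :
  @measurable_fun _ _ T (sub k) setT idfun.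
Proof.
have [/(_ k)[_ Gm _] _ _ _] := nonant.
by move=> _ A; rewrite setTI sub_measurableE => /Gm.
Qed.

Lemma sub_measurable_fun {dU : measure_display} {U : measurableType dU} k
    (g : T -> U) : measurable_fun setT (g : sub k -> U) -> measurable_fun setT g.
Proof.
move=> mg _ A mA; rewrite -[g @^-1` A]/(idfun @^-1` (g @^-1` A)).
apply: (sub_measurable_id measurableT).
by rewrite -[X in measurable X]setTI; exact: mg.
Qed.

Lemma sub_measurable_idS k :
  @measurable_fun _ _ (sub k.+1) (sub k) setT idfun.
Proof.
have [/(_ k)[_ _ GS] _ _ _] := nonant.
by move=> _ A; rewrite setTI !sub_measurableE => /GS.
Qed.

Lemma sub_measurable_funS {dU : measure_display} {U : measurableType dU} k
    (g : T -> U) : measurable_fun setT (g : sub k -> U) ->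
  measurable_fun setT (g : sub k.+1 -> U).
Proof.
move=> mg _ A mA; rewrite -[g @^-1` A]/(idfun @^-1` (g @^-1` A)).
apply: (sub_measurable_idS measurableT).
by rewrite -[X in measurable X]setTI; exact: mg.
Qed.

Lemma sub_measurable_xi k : measurable_fun setT (xi k : sub k -> Xi).
Proof.
have [_ Gxi _ _] := nonant.
by move=> _ A mA; rewrite setTI sub_measurableE; exact: Gxi.
Qed.

Let mxi k : measurable_fun setT (xi k).
Proof. by have [] := samples. Qed.

(* Identity maps into T with a coarser sigma-algebra: independence of the next
   sample becomes a product law, and Fubini stands in for conditioning. *)
Let past k : {mfun T >-> sub k} := mfun_Sub (mem_set (@sub_measurable_id k)).

Let fresh k : {mfun T >-> Xi} := mfun_Sub (mem_set (mxi k.+1)).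

Let indep k A B : measurable A -> measurable B ->
  (P (past k @^-1` A `&` fresh k @^-1` B) = P (past k @^-1` A) * mu B)%E.
Proof.
rewrite sub_measurableE => GA mB.
have [_ _ ind _] := nonant; have [_ law _] := samples.
by rewrite -(law k.+1 _ mB); exact: ind.
Qed.

Lemma ge0_integral_fresh k (g : T -> Xi -> \bar R) :
  measurable_fun setT (fun p : sub k * Xi => g p.1 p.2) ->
  (forall w s, (0 <= g w s)%E) ->
  (\int[P]_w g w (xi k.+1 w) = \int[P]_w \int[mu]_s g w s)%E.
Proof.
by move=> mg g0; apply: (ge0_integral_joint (@indep k) mg) => -[w s]; exact: g0.
Qed.

(** The tower property for a martingale increment: if it integrates to 0 over the fresh sample for
    every frozen past, its expectation is 0. *)
Lemma integral_fresh_eq0 k (g : T -> Xi -> \bar R) :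
  measurable_fun setT (fun p : sub k * Xi => g p.1 p.2) ->
  P.-integrable setT (fun w => g w (xi k.+1 w)) ->
  (forall w, \int[mu]_s g w s = 0)%E ->
  (\int[P]_w g w (xi k.+1 w) = 0)%E.
Proof.
move=> mg ig g0; rewrite [LHS](integral_joint (@indep k) mg ig).
by under eq_integral do rewrite g0; exact: integral0.
Qed.

Lemma sub_measurable_fresh {dU : measure_display} {U : measurableType dU} k
    (g : T -> Xi -> U) :
  measurable_fun setT (fun p : sub k * Xi => g p.1 p.2) ->
  measurable_fun setT ((fun w => g w (xi k.+1 w)) : sub k.+1 -> U).
Proof.
move=> mg.
have mf : @measurable_fun _ _ (sub k.+1) (sub k * Xi)%type setT
    (fun w => (w, xi k.+1 w)).
  apply: measurable_fun_pair; first exact: sub_measurable_idS.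
  exact: sub_measurable_xi.
exact: (measurableT_comp mg mf).
Qed.

Section martingale.
Variables (r q m : R) (h : nat -> T -> Xi -> R) (S : nat -> T -> R).
Hypotheses (r1 : 1 < r) (r2 : r <= 2) (q0 : 0 <= q) (q1 : q < 1).
Hypothesis mh : forall k, measurable_fun setT (fun p : sub k * Xi => h k p.1 p.2).
Hypothesis h0 : forall k w, (\int[mu]_s (h k w s)%:E = 0)%E.
Hypothesis hm : forall k w, (\int[mu]_s (`|h k w s| `^ r)%:E <= m%:E)%E.
Hypothesis S0 : forall w, S 0%N w = 0.
Hypothesis SS : forall k w, S k.+1 w = q * S k w + h k w (xi k.+1 w).

Lemma martingale_measurable k : measurable_fun setT (S k : sub k -> R).
Proof.
elim: k => [|k IH].
  by rewrite (_ : S 0%N = cst 0)//; apply/funext.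
rewrite (_ : S k.+1 = fun w => q * S k w + h k w (xi k.+1 w)); last exact/funext.
apply: measurable_funD; last exact: sub_measurable_fresh.
by apply: measurable_funM => //; exact: sub_measurable_funS.
Qed.

(** The bound 6 m / (1 - q) is the fixed point of c = q c + 6 m, and |q S|^r <= q |S|^r since 0 <= q
    < 1 < r, so the induction closes. *)
Lemma martingale_moment k : (\int[P]_w (`|S k w| `^ r)%:E <= (6 * m / (1 - q))%:E)%E.
Proof.
have r0 : r != 0 by rewrite gt_eqF// (lt_trans _ r1).
have m0 : 0 <= m.
  rewrite -lee_fin; apply: le_trans (hm 0%N point).
  by apply: integral_ge0 => s _; rewrite lee_fin powR_ge0.
elim: k => [|k IH].
  rewrite (eq_integral (cst 0%E)) ?integral0; last first.
    by move=> w _; rewrite S0 normr0 powR0.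
  by rewrite lee_fin divr_ge0 ?mulr_ge0// subr_ge0 ltW.
under eq_integral do rewrite SS.
have mSk : measurable_fun setT (S k).
  exact: (sub_measurable_fun (@martingale_measurable k)).
have mS : measurable_fun setT (fun w => q * S k w : R).
  exact: measurable_funM.
have mM : measurable_fun setT (fun w => h k w (xi k.+1 w)).
  apply: (@sub_measurable_fun _ _ k.+1).
  exact: (@sub_measurable_fresh _ _ k (h k)).
have HA : (\int[P]_w (`|q * S k w| `^ r)%:E <= (q * (6 * m / (1 - q)))%:E)%E.
  apply: (@le_trans _ _ (\int[P]_w (q%:E * (`|S k w| `^ r)%:E))%E).
    apply: ge0_le_integral => //.
    - exact/measurable_EFinP/measurable_norm_powR.
    - apply/measurable_EFinP/measurable_funM => //.
      exact: measurable_norm_powR.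
    - move=> w _; rewrite -EFinM lee_fin normrM powRM//.
      rewrite ler_wpM2r ?powR_ge0// (ger0_norm q0).
      have [->|qN0] := eqVneq q 0; first by rewrite powR0.
      by rewrite ge1r_powR ?(ltW r1)// lt_neqAle eq_sym qN0 q0 ltW.
  rewrite ge0_integralZl//.
  - by rewrite EFinM lee_wpmul2l ?lee_fin.
  - exact/measurable_EFinP/measurable_norm_powR.
have mhr : measurable_fun setT (fun p : sub k * Xi => (`|h k p.1 p.2| `^ r)%:E).
  apply/measurable_EFinP; exact: (measurable_norm_powR _ (@mh k)).
have HB : (\int[P]_w (`|h k w (xi k.+1 w)| `^ r)%:E <= m%:E)%E.
  rewrite (@ge0_integral_fresh k (fun w s => (`|h k w s| `^ r)%:E)).
  - apply: (@le_trans _ _ (\int[P]_w (cst m%:E w))%E).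
      apply: ge0_le_integral => //.
      + by move=> w _; apply: integral_ge0 => s _; rewrite lee_fin powR_ge0.
      + apply: (sub_measurable_fun (k := k)).
        apply: (measurable_fun_fubini_tonelli_F (m2 := mu) _ mhr).
        by move=> p; rewrite lee_fin powR_ge0.
    by rewrite integral_cst//= probability_setT mule1.
  - exact: mhr.
  - by move=> w s; rewrite lee_fin powR_ge0.
have := expected_powR_normD r1 r2 mS mM HA HB.
rewrite (_ : q * (6 * m / (1 - q)) + 6 * m = 6 * m / (1 - q)); last first.
  by field; rewrite subr_eq0 gt_eqF.
apply.
(* With the past frozen, the signed power is a constant factor and the increment has mean 0. *)
apply: (@integral_fresh_eq0 k (fun w s => (spow (r - 1) (q * S k w) * h k w s)%:E)).
- apply/measurable_EFinP/measurable_funM; last exact: (@mh k).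
  apply: (measurableT_comp (measurable_spow _)).
  apply: measurable_funM => //.
  exact: (measurableT_comp (@martingale_measurable k)).
- exact: (integrable_spow_mul r1 mS mM HA HB).
move=> w; under eq_integral do rewrite EFinM.
rewrite integralZl//; last first.
  apply/integrableP; split.
    apply/measurable_EFinP.
    exact: (measurableT_comp (@mh k) (@pair1_measurable _ _ (sub k) Xi w)).
  have mhw : measurable_fun setT (h k w).
    exact: (measurableT_comp (@mh k) (@pair1_measurable _ _ (sub k) Xi w)).
  apply: le_lt_trans (expected_norm_le r1 ltr01 mhw (hm k w)) _.
  by rewrite ltry.
by rewrite h0 mule0.
Qed.

End martingale.
End filtration.

(** * Measurability of compact sets and of oracles along random points *)

Section borel_cV.
Context {R : realType} {d : nat}.

Lemma measurable_coord (i : 'I_d) :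
  measurable_fun setT (fun x : borel_cV R d => x i 0).
Proof.
move=> _ A mA; apply: sub_sigma_algebra; exists i => //.
by exists A.
Qed.

Lemma measurable_to_borel_cV {dT} {T : measurableType dT} (g : T -> 'cV[R]_d) :
  (forall i, measurable_fun setT (fun w => g w i 0)) ->
  @measurable_fun _ _ T (borel_cV R d) setT g.
Proof.
move=> mg; apply: (@measurability _ _ T (borel_cV R d) setT g
  (\bigcup_(i : 'I_d) preimage_set_system setT (fun x : 'cV[R]_d => x i 0)
     measurable) erefl).
move=> _ [_ [i _ [A mA <-]] <-].
have := mg i measurableT A mA.
by rewrite !setTI.
Qed.

Lemma measurable_ball_cV (x : 'cV[R]_d) e : 0 < e ->
  measurable (ball x e : set (borel_cV R d)).
Proof.
move=> e0; rewrite (_ : ball x e = \bigcap_(i in [set: 'I_d])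
    ((fun y : borel_cV R d => y i 0) @^-1` ball (x i 0) e)); last first.
  apply/seteqP; split => [y [_ xy] i _|y xy]; first exact: xy.
  by split=> // i j; rewrite (ord1 j); exact: (xy i).
apply: fin_bigcap_measurable => // i _; rewrite -[X in measurable X]setTI.
by apply: measurable_coord => //; exact: measurable_ball.
Qed.

(** The oracles are measurable on X * Xi only, so X itself must be measurable for a sigma-algebra
    generated by coordinates. X is the intersection over n of finite unions of balls of radius 1 /
    (n + 1); the centres lie in X, so a point of the intersection is a limit of points of X, and X
    is closed. *)
Lemma compact_borel_cV (X : set 'cV[R]_d) : compact X ->
  measurable (X : set (borel_cV R d)).
Proof.
move=> cX.
have net (n : nat) : exists F : {fset 'cV[R]_d},
    {subset F <= X} /\ X `<=` \bigcup_(x in [set` F]) ball x n.+1%:R^-1.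
  move: cX; rewrite compact_cover => /(_ _ X (fun x => (ball x n.+1%:R^-1)^°)).
  case=> [x Xx||F FX XF].
  - exact: open_interior.
  - by move=> x Xx; exists x => //; apply: nbhsx_ballx.
  exists F; split => // x /XF[z zF xz]; exists z => //.
  exact: interior_subset xz.
have /choice[F HF] := net.
rewrite (_ : X = \bigcap_n \bigcup_(x in [set` F n]) ball x n.+1%:R^-1).
  apply: bigcap_measurableType => n _.
  apply: fin_bigcup_measurable => // x _; exact: measurable_ball_cV.
apply/seteqP; split => [x Xx n _|x HX].
  by have [_] := HF n; exact.
have hX : hausdorff_space 'cV[R]_d.
  exact: norm_hausdorff.
have := compact_closed hX cX; rewrite closedE; apply.
move=> /nbhs_ballP[e /= e0 xU].
have [n _ ne] : \forall n \near \oo, n.+1%:R^-1 < e.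
  exact: near_infty_natSinv_lt (PosNum e0).
have [z zF zx] := HX n I.
have [FX _] := HF n.
apply: (xU z); last exact: set_mem (FX z zF).
apply: ball_sym; apply: le_ball zx; exact/ltW/ne/leqnn.
Qed.

End borel_cV.

Section oracle.
Context {R : realType} {d m n : nat} {dX dT : measure_display}
  {Xi : measurableType dX} {T : measurableType dT}.
Variables (X : set 'cV[R]_d) (h : 'cV[R]_d -> Xi -> 'M[R]_(m, n)).
Hypotheses (X_compact : compact X) (mh : measurable_oracle X h).

Lemma measurable_oracle_comp (y : T -> 'cV[R]_d) i j :
  (forall i, measurable_fun setT (fun w => y w i 0)) -> (forall w, X (y w)) ->
  measurable_fun setT (fun p : T * Xi => h (y p.1) p.2 i j).
Proof.
move=> my yX.
have mg : @measurable_fun _ _ (T * Xi)%type (borel_cV R d * Xi)%type setT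
    (fun p => (y p.1, p.2)).
  apply: measurable_fun_pair => //.
  exact: (measurableT_comp (measurable_to_borel_cV my)).
apply: (measurable_comp _ _ (mh i j) mg).
  rewrite (_ : [set p | X p.1] = X `*` setT).
    exact: measurableX (compact_borel_cV X_compact) measurableT.
  by apply/seteqP; split => [p|p []].
by move=> _ [p _ <-] /=.
Qed.

(** Measurability of [g] along [y] is a consequence of unbiasedness: [g] is the integral of a
    jointly measurable function over the sample. Tonelli is applied to the positive and negative
    parts separately. *)
Lemma measurable_oracle_mean (mu : probability Xi R) (g : 'cV[R]_d -> 'M[R]_(m, n))
    (y : T -> 'cV[R]_d) i j : unbiased_on mu X h g ->
  (forall i, measurable_fun setT (fun w => y w i 0)) -> (forall w, X (y w)) ->
  measurable_fun setT (fun w => g (y w) i j).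
Proof.
move=> ub my yX; have mhy := measurable_oracle_comp i j my yX.
apply/measurable_EFinP.
rewrite (_ : EFin \o _ = fun w => \int[mu]_s (h (y w) s i j)%:E)%E; last first.
  by apply/funext => w /=; rewrite -ub// unlock.
pose k (p : T * Xi) := (h (y p.1) p.2 i j)%:E : \bar R.
have mk : measurable_fun setT k by exact/measurable_EFinP.
rewrite (_ : (fun w => _) = fun w => \int[mu]_s k^\+ (w, s) - \int[mu]_s k^\- (w, s))%E.
  apply: emeasurable_funB.
    apply: (measurable_fun_fubini_tonelli_F (m2 := mu) (k^\+)%E) => //.
    exact: measurable_funepos.
  apply: (measurable_fun_fubini_tonelli_F (m2 := mu) (k^\-)%E) => //.
  exact: measurable_funeneg.
apply/funext => w; rewrite [LHS]integralE.
by congr (_ - _)%E; apply: eq_integral => s _; rewrite !(funeposE, funenegE).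
Qed.

End oracle.

(** * Taylor expansion relative to a convex set *)

Section taylor.
Context {R : realType} {d n : nat}.
Variables (X : set 'cV[R]_d) (f : 'cV[R]_d -> 'cV[R]_n)
  (Jf : 'cV[R]_d -> 'M[R]_(n, d)) (L : R).
Hypotheses (X_convex : convex_set X) (f_jacobian : has_jacobian_on X f Jf).
Hypothesis Jf_lipschitz : forall x y, X x -> X y ->
  opnorm (Jf x - Jf y) <= L * enorm (x - y).

Lemma convex_comb_in x y t : 0 <= t -> t <= 1 -> X x -> X y ->
  X ((1 - t) *: x + t *: y).
Proof.
move=> t0 t1 Xx Xy.
have /set_mem := @X_convex y x (Itv01 t0 t1) (mem_set Xy) (mem_set Xx).
by rewrite /conv/= addrC.
Qed.

Lemma segment_in x y t : 0 <= t -> t <= 1 -> X x -> X y ->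
  X (x + t *: (y - x)).
Proof.
move=> t0 t1 Xx Xy; rewrite (_ : _ + _ = (1 - t) *: x + t *: y).
  exact: convex_comb_in.
by rewrite scalerBl scale1r scalerBr addrA addrAC.
Qed.

Section on_segment.
Variables (x y : 'cV[R]_d) (i : 'I_n).
Hypotheses (Xx : X x) (Xy : X y).

Let pt (t : R) : 'cV[R]_d := x + t *: (y - x).
Let g (t : R) : R := f (pt t) i 0.
Let dg (t : R) : R := (Jf (pt t) *m (y - x)) i 0.

Let expansion (t e : R) : 0 <= t <= 1 -> 0 < e ->
  \forall s \near t, 0 <= s <= 1 -> `|g s - g t - (s - t) * dg t| <= e * `|s - t|.
Proof.
move=> /andP[t0 t1] e0; have Xt : X (pt t) by exact: segment_in.
(* Differentiability is used with tolerance e / c, so that a displacement of length at most c |s -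
   t| costs e |s - t|; the [+ 1] keeps c positive when x = y. *)
pose c := l1norm (y - x) + 1.
have c0 : 0 < c by rewrite ltr_wpDl ?l1norm_ge0.
have := f_jacobian Xt (divr_gt0 e0 c0).
rewrite near_withinE => Jnear.
have pt_cont : pt s @[s --> t] --> pt t.
  rewrite /pt; apply: cvgD; first exact: cvg_cst.
  exact: (@scalel_continuous R 'cV[R]_d (y - x) t).
have H0 : \forall s \near t, X (pt s) ->
    enorm (f (pt s) - f (pt t) - Jf (pt t) *m (pt s - pt t)) <=
      e / c * enorm (pt s - pt t) by exact: pt_cont Jnear.
apply: filterS H0 => s H /andP[s0 s1].
have ptB : pt s - pt t = (s - t) *: (y - x).
  by rewrite /pt opprD addrACA subrr add0r scalerBl.
have := H (segment_in s0 s1 Xx Xy).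
rewrite ptB => {}H.
have := entry_le_enorm (f (pt s) - f (pt t) - Jf (pt t) *m ((s - t) *: (y - x))) i 0.
rewrite entryBB -[in X in _ - X]scalemxAr entryZ => /le_trans; apply.
rewrite (le_trans H)//.
apply: (@le_trans _ _ (e / c * l1norm ((s - t) *: (y - x)))).
  by rewrite ler_wpM2l ?enorm_le_l1norm// divr_ge0 ?ltW.
rewrite l1normZ mulrCA mulrC ler_wpM2r//.
rewrite -mulrA ler_piMr ?(ltW e0)// mulrC ler_pdivrMr// mul1r.
by rewrite /c lerDl.
Qed.

Let g_derive (t : R) : t \in `]0, 1[ -> is_derive t 1 g (dg t).
Proof.
rewrite in_itv/= => /andP[t0 t1].
have H : h^-1 *: ((g \o shift t) (h *: (1 : R^o)) - g t) @[h --> 0^'] --> dg t.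
  apply/cvgrPdist_le => e e0.
  have t01 : 0 <= t <= 1 by rewrite !ltW.
  have := expansion t01 e0.
  move=> /nbhs_ballP[dl /= dl0 Hd].
  near=> h.
  have h0 : h != 0 by near: h; exact: nbhs_dnbhs_neq.
  have hd : `|h| < dl by near: h; exact: dnbhs0_lt.
  (* Staying within t and 1 - t of t keeps the point in [0, 1], where the expansion relative to X is
     available. *)
  have /ltr_normlP[ht _] : `|h| < t by near: h; exact: dnbhs0_lt.
  have /ltr_normlP[_ h1] : `|h| < 1 - t by near: h; apply: dnbhs0_lt; rewrite subr_gt0.
  have : ball t dl (h + t) by rewrite -ball_normE/= opprD addrCA subrr addr0 normrN.
  move=> /Hd; rewrite addrK => Hh.
  rewrite /shift/= -(ler_pM2l (_ : 0 < `|h|)) ?normr_gt0// -normrM.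
  have E (a b c : R) : h * (c - h^-1 * (a - b)) = - (a - b - h * c) by field.
  rewrite [h *: _]mulr1 [leLHS](_ : _ = `|- (g (h + t) - g t - h * dg t)|).
    by rewrite normrN [leRHS]mulrC; apply: Hh; lra.
  by congr Num.norm; exact: E.
apply: DeriveDef; first by apply/cvg_ex; exists (dg t).
exact: cvg_lim.
Unshelve. all: by end_near.
Qed.

Let g_continuous : {within `[0, 1], continuous g}.
Proof.
apply/subspace_continuousP => t; rewrite /= in_itv/= => t01.
apply/cvgrPdist_le => e e0.
(* The expansion with tolerance 1 bounds |g s - g t| by c |s - t|; it holds at the endpoints too,
   where no two-sided derivative is at hand. *)
pose c := 1 + `|dg t|; have c0 : 0 < c by rewrite ltr_pwDl.
have t01' : 0 <= t <= 1 by [].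
rewrite near_withinE; have := expansion t01' ltr01.
have := nbhsx_ballx t (e / c) (divr_gt0 e0 c0).
apply: filterS2 => s + H; rewrite -ball_normE/= in_itv/= => ts s01.
have {H} := H s01; rewrite mul1r => H.
have : `|(s - t) * dg t| = `|s - t| * `|dg t| by rewrite normrM.
move: ts; rewrite ltr_pdivlMr// /c distrC mulrDr mulr1 => ts E.
rewrite distrC -(subrK ((s - t) * dg t) (g s - g t)).
by rewrite (le_trans (ler_normD _ _))// E; lra.
Qed.

(** The mean value theorem on the segment, one coordinate at a time because the intermediate point
    depends on the coordinate. The Jacobian there differs from [Jf x] by at most |L| times the
    length of the segment; the absolute value appears because no sign of [L] is assumed. *)
Lemma taylor_entry :
  `|f y i 0 - f x i 0 - (Jf x *m (y - x)) i 0| <=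
    (n * d)%:R * `|L| * l1norm (y - x) ^+ 2.
Proof.
have [c] := MVT ltr01 g_derive g_continuous.
rewrite in_itv/= => /andP[c0 c1].
have pt0 : pt 0 = x by rewrite /pt scale0r addr0.
have pt1 : pt 1 = y by rewrite /pt scale1r addrC subrK.
rewrite /g pt0 pt1 subr0 mulr1 => ->.
have Xc : X (pt c) by apply: segment_in => //; exact: ltW.
rewrite -[_ - _](_ : ((Jf (pt c) - Jf x) *m (y - x)) i 0 = _); last first.
  by rewrite mulmxBl mxE [X in _ + X]mxE.
rewrite (le_trans (entry_le_l1norm _ _ _))// (le_trans (l1norm_mul _ _))//.
rewrite expr2 mulrA ler_wpM2r ?l1norm_ge0//.
rewrite -mulrA; apply: l1norm_le_entries => j k.
rewrite (le_trans (entry_le_opnorm _ _ _))// (le_trans (Jf_lipschitz Xc Xx))//.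
rewrite (le_trans (ler_wpM2r (enorm_ge0 _) (ler_norm L)))//.
rewrite ler_wpM2l// (le_trans (enorm_le_l1norm _))//.
rewrite /pt [x + _]addrC addrK l1normZ gtr0_norm// ler_piMl ?l1norm_ge0//.
exact: ltW.
Qed.

End on_segment.

Lemma taylor x y : X x -> X y ->
  l1norm (f y - f x - Jf x *m (y - x)) <=
    n%:R * ((n * d)%:R * `|L| * l1norm (y - x) ^+ 2).
Proof.
move=> Xx Xy; rewrite -[n in n%:R * _]muln1; apply: l1norm_le_entries => i j.
rewrite (ord1 j) entryBB.
exact: taylor_entry.
Qed.

End taylor.

(** * Frank-Wolfe analysis along one sample path *)

Lemma minimum_argmin {R : realType} {U : Type} (X : set U) (g : U -> R) x :
  is_argmin X g x -> minimum X g = g x.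
Proof.
move=> [Xx gx]; apply/eqP; rewrite eq_le; apply/andP; split.
  by apply: ge_inf; [exists (g x) => _ [x' Xx' <-]; exact: gx|exists x].
by apply: lb_le_inf; [exists (g x), x|move=> _ [x' Xx' <-]; exact: gx].
Qed.

(** The recursion telescopes as a p_k <= p_k - p_{k+1} + a q_k. The induction keeps p_K on the left,
    where it absorbs the last term a p_K. *)
Lemma contraction_sum {R : realFieldType} (a : R) (p q : nat -> R) K :
  a <= 1 -> (forall k, 0 <= p k) ->
  (forall k, p k.+1 <= (1 - a) * p k + a * q k) ->
  a * \sum_(k < K.+1) p k <= p 0%N + a * \sum_(k < K) q k.
Proof.
move=> a1 p0 pS.
suff H : a * \sum_(k < K) p k + p K <= p 0%N + a * \sum_(k < K) q k.
  apply: le_trans H; rewrite big_ord_recr/= mulrDr lerD2l.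
  by rewrite ler_piMl.
elim: K => [|K IH]; first by rewrite !big_ord0 !mulr0 add0r addr0.
by rewrite !big_ord_recr/= !mulrDr; have := pS K; lra.
Qed.

Section frank_wolfe.
Context {R : realType} {d n : nat}.
Variables (X : set 'cV[R]_d) (F : 'cV[R]_n -> 'cV[R]_d -> R)
  (f : 'cV[R]_d -> 'cV[R]_n) (Jf : 'cV[R]_d -> 'M[R]_(n, d)) (LF L D : R).
Hypotheses (X_convex : convex_set X)
  (F_convex : convex_function (setT `*` X)
     (fun p : 'cV[R]_n * 'cV[R]_d => F p.1 p.2))
  (F_lipschitz : forall x (u v : 'cV[R]_n), X x ->
     `|F u x - F v x| <= LF * enorm (u - v))
  (f_jacobian : has_jacobian_on X f Jf)
  (Jf_lipschitz : forall x y, X x -> X y ->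
     opnorm (Jf x - Jf y) <= L * enorm (x - y))
  (gap_attained : forall y, X y ->
     exists x, is_argmin X (linearized F (f y) (Jf y) y) x)
  (X_bounded : forall x y, X x -> X y -> l1norm (x - y) <= D).

Let ct := n%:R * ((n * d)%:R * `|L|).

Let ct0 : 0 <= ct. Proof. by rewrite !mulr_ge0. Qed.

Let taylor_step x y l : X x -> X y -> l1norm (y - x) <= l ->
  l1norm (f y - f x - Jf x *m (y - x)) <= ct * l ^+ 2.
Proof.
move=> Xx Xy xyl.
rewrite (le_trans (taylor X_convex f_jacobian Jf_lipschitz Xx Xy))//.
rewrite /ct -!mulrA !ler_wpM2l// ler_sqr ?nnegrE ?l1norm_ge0//.
exact: le_trans (l1norm_ge0 _) xyl.
Qed.

Lemma outer_le x (u v : 'cV[R]_n) : X x ->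
  F u x <= F v x + `|LF| * l1norm (u - v).
Proof.
move=> Xx; rewrite -lerBlDl (le_trans (ler_norm _))//.
rewrite (le_trans (F_lipschitz _ _ Xx))//.
rewrite (le_trans (ler_wpM2r (enorm_ge0 _) (ler_norm LF)))//.
by rewrite ler_wpM2l// enorm_le_l1norm.
Qed.

Lemma outer_convex u v x y t : 0 <= t -> t <= 1 -> X x -> X y ->
  F ((1 - t) *: u + t *: v) ((1 - t) *: x + t *: y) <=
    (1 - t) * F u x + t * F v y.
Proof.
move=> t0 t1 Xx Xy.
have H : F (t *: v + (1 - t) *: u) (t *: y + (1 - t) *: x) <=
    t * F v y + (1 - t) * F u x.
  exact: (F_convex (Itv01 t0 t1) (mem_set (conj I Xy : (setT `*` X) (v, y)))
    (mem_set (conj I Xx : (setT `*` X) (u, x)))).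
by rewrite [_ *: u + _]addrC [_ *: x + _]addrC [leRHS]addrC.
Qed.

Lemma fw_gap_ge0 y : X y -> 0 <= fw_gap X F f Jf y.
Proof.
move=> Xy; have [x xmin] := gap_attained Xy.
rewrite /fw_gap (minimum_argmin xmin) subr_ge0.
have [_ /(_ y Xy)] := xmin.
by rewrite {2}/linearized subrr mulmx0 addr0.
Qed.

Lemma linearized_le (u v : 'cV[R]_n) (A B : 'M[R]_(n, d)) x y : X x -> X y ->
  linearized F u A y x <= linearized F v B y x
    + `|LF| * (l1norm (u - v) + l1norm (A - B) * D).
Proof.
move=> Xx Xy; rewrite (le_trans (outer_le _ (v + B *m (x - y)) Xx))//.
rewrite lerD2l ler_wpM2l// opprD addrACA -mulmxBl.
rewrite (le_trans (l1normD _ _))// lerD2l (le_trans (l1norm_mul _ _))//.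
by rewrite ler_wpM2l ?l1norm_ge0// X_bounded.
Qed.

Lemma descent a x y y' (z : 'cV[R]_n) (V : 'M[R]_(n, d)) : 0 <= a -> a <= 1 ->
  X y -> is_argmin X (linearized F z V y) x ->
  y' = (1 - a) *: y + a *: x ->
  F (f y') y' <= F (f y) y - a * fw_gap X F f Jf y
    + 2 * `|LF| * (a * (l1norm (z - f y) + l1norm (V - Jf y) * D))
    + `|LF| * ct * D ^+ 2 * a ^+ 2.
Proof.
move=> a0 a1 Xy [Xx xmin] y'E.
have Xy' : X y' by rewrite y'E; exact: convex_comb_in.
have y'B : y' - y = a *: (x - y).
  by rewrite y'E; apply/matrixP => i j; rewrite !mxE; ring.
set G := fw_gap _ _ _ _ y.
set e := l1norm (z - f y) + l1norm (V - Jf y) * D.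
have h1 : F (f y') y' <= F (f y + Jf y *m (y' - y)) y' + `|LF| * (ct * (a * D) ^+ 2).
  rewrite (le_trans (outer_le _ (f y + Jf y *m (y' - y)) Xy'))// lerD2l ler_wpM2l//.
  rewrite opprD addrA taylor_step// y'B l1normZ ger0_norm// ler_wpM2l//.
  exact: X_bounded.
(* The linearized argument at y' is itself the convex combination of (f y, y) and (f y + Jf y (x -
   y), x), so joint convexity applies. *)
have h2 : F (f y + Jf y *m (y' - y)) y' <=
    (1 - a) * F (f y) y + a * linearized F (f y) (Jf y) y x.
  apply: le_trans (outer_convex _ _ a0 a1 Xy Xx).
  rewrite -y'E y'B -scalemxAr scalerDr addrA -scalerDl subrK scale1r.
  exact: lexx.
(* Tracked and exact models are exchanged twice, at x here and at the exact minimizer x' in [h5];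
   this is the origin of the factor 2. *)
have h3 : linearized F (f y) (Jf y) y x <= linearized F z V y x + `|LF| * e.
  rewrite (le_trans (linearized_le _ z _ V Xx Xy))//.
  by rewrite -opprB l1normN -[Jf y - V]opprB l1normN.
have [x' x'min] := gap_attained Xy.
have [Xx' _] := x'min.
have h4 := xmin _ Xx'.
have h5 := linearized_le z (f y) V (Jf y) Xx' Xy.
have GE : G = F (f y) y - linearized F (f y) (Jf y) y x'.
  by rewrite /G /fw_gap (minimum_argmin x'min).
have h6 : linearized F (f y) (Jf y) y x <= F (f y) y - G + 2 * (`|LF| * e).
  rewrite GE; rewrite -/e in h5; lra.
have := ler_wpM2l a0 h6.
have -> : `|LF| * ct * D ^+ 2 * a ^+ 2 = `|LF| * (ct * (a * D) ^+ 2) by ring.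
have -> : 2 * `|LF| * (a * e) = a * (2 * (`|LF| * e)) by ring.
lra.
Qed.

Section run.
Variables (a fmin : R) (x y : nat -> 'cV[R]_d) (z tf s : nat -> 'cV[R]_n)
  (V S : nat -> 'M[R]_(n, d)) (tg tg' : nat -> 'M[R]_(n, d)).
Hypotheses (a0 : 0 <= a) (a1 : a <= 1) (y0_in : X (y 0%N)).
Hypothesis fminE : forall x, X x -> fmin <= F (f x) x.
Hypothesis run_V : forall k, V k.+1 = tg k + (1 - a) *: (V k - tg' k).
Hypothesis run_z : forall k,
  z k.+1 = (1 - a) *: (z k + V k.+1 *m (y k.+1 - y k)) + a *: tf k.
Hypothesis run_x : forall k, is_argmin X (linearized F (z k) (V k) (y k)) (x k.+1).
Hypothesis run_y : forall k, y k.+1 = (1 - a) *: y k + a *: x k.+1.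
Hypotheses (S0 : S 0%N = 0) (s0 : s 0%N = 0).
Hypothesis SS : forall k, S k.+1 = (1 - a) *: S k +
  ((tg k - Jf (y k.+1)) - (1 - a) *: (tg' k - Jf (y k))).
Hypothesis sS : forall k, s k.+1 = (1 - a) *: s k + a *: (tf k - f (y k.+1)).

Lemma iterate_in k : X (y k).
Proof.
by elim: k => // k IH; rewrite run_y; apply: convex_comb_in => //; have [] := run_x k.
Qed.

Let stepE k : y k.+1 - y k = a *: (x k.+1 - y k).
Proof. by rewrite run_y; apply/matrixP => i j; rewrite !mxE; ring. Qed.

Lemma step_le k : l1norm (y k.+1 - y k) <= a * D.
Proof.
rewrite stepE l1normZ ger0_norm// ler_wpM2l// X_bounded//; last exact: iterate_in.
by have [] := run_x k.
Qed.

Let E k := l1norm (V k - Jf (y k)).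
Let e k := l1norm (z k - f (y k)).

(** Once S_k is removed, the error of V_k is multiplied by exactly 1 - a at each step, with no
    forcing term: the two evaluations at the same sample cancel. *)
Lemma jacobian_tracking K :
  a * \sum_(k < K.+1) E k <= E 0%N + a * \sum_(k < K.+1) l1norm (S k).
Proof.
pose p k := l1norm (V k - Jf (y k) - S k).
have pS k : p k.+1 <= (1 - a) * p k + a * 0.
  rewrite mulr0 addr0 /p -[1 - a]ger0_norm ?subr_ge0// -l1normZ.
  rewrite [leLHS](_ : _ = l1norm ((1 - a) *: (V k - Jf (y k) - S k)))//.
  congr l1norm; rewrite run_V SS.
  by apply/matrixP => i j; rewrite !mxE; ring.
have := @contraction_sum _ a p (fun=> 0) K a1 (fun k => l1norm_ge0 _) pS.
rewrite [X in _ + a * X]big1 ?mulr0 ?addr0// {2}/p S0 subr0 -/(E 0%N) => H.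
rewrite -lerBlDr (le_trans _ H)// -mulrBr ler_wpM2l// -sumrB.
apply: ler_sum => k _; rewrite lerBlDr /E.
by rewrite -{1}(subrK (S k) (V k - _)) l1normD.
Qed.

(** Once s_k is removed, the error of z_k is forced by (V_{k+1} - Jf(y_{k+1})) applied to the step
    and by a Taylor remainder. The step has length at most a D, so the forcing has the form a q_k
    required by [contraction_sum]. *)
Lemma function_tracking K :
  a * \sum_(k < K.+1) e k <= e 0%N + a * \sum_(k < K.+1) l1norm (s k)
    + D * (a * \sum_(k < K.+1) E k) + ct * D ^+ 2 * (K.+1%:R * a ^+ 2).
Proof.
pose p k := l1norm (z k - f (y k) - s k).
pose q k := D * E k.+1 + ct * a * D ^+ 2.
have D0 : 0 <= D by exact: le_trans (l1norm_ge0 _) (X_bounded y0_in y0_in).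
have pS k : p k.+1 <= (1 - a) * p k + a * q k.
  pose dl := y k.+1 - y k.
  (* The expansion is centred at the new point and read backwards, since the tracker uses V_{k+1}
     and not V_k. *)
  pose T := f (y k) - f (y k.+1) - Jf (y k.+1) *m (y k - y k.+1).
  have TE : T = f (y k) - f (y k.+1) + Jf (y k.+1) *m dl.
    by rewrite /T /dl -[y k - y k.+1]opprB mulmxN opprK.
  have T_le : l1norm T <= ct * (a * D) ^+ 2.
    apply: taylor_step; try exact: iterate_in.
    by rewrite -opprB l1normN step_le.
  have -> : p k.+1 = l1norm ((1 - a) *: ((z k - f (y k) - s k) +
      ((V k.+1 - Jf (y k.+1)) *m dl + T))).
    congr l1norm; rewrite run_z sS TE mulmxBl.
    rewrite -/dl; move: (V k.+1 *m dl) (Jf (y k.+1) *m dl) => u v.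
    by apply/matrixP => i j; rewrite !mxE; ring.
  rewrite l1normZ ger0_norm ?subr_ge0//.
  have h1 : l1norm ((V k.+1 - Jf (y k.+1)) *m dl + T) <= a * q k.
    rewrite (le_trans (l1normD _ _))//.
    have -> : a * q k = E k.+1 * (a * D) + ct * (a * D) ^+ 2 by rewrite /q; ring.
    rewrite lerD// (le_trans (l1norm_mul _ _))// ler_wpM2l ?l1norm_ge0//.
    exact: step_le.
  have q0 : 0 <= a * q k.
    by rewrite mulr_ge0// addr_ge0// ?mulr_ge0 ?l1norm_ge0 ?sqr_ge0.
  apply: (@le_trans _ _ ((1 - a) * (p k + a * q k))).
    by rewrite ler_wpM2l ?subr_ge0// (le_trans (l1normD _ _))// lerD2l.
  by rewrite mulrDr lerD2l ler_piMl// lerBlDr lerDl.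
have := @contraction_sum _ a p q K a1 (fun k => l1norm_ge0 _) pS.
rewrite {2}/p s0 subr0 -/(e 0%N) => H.
(* The forcing q_k involves E_{k+1}; for k < K these are among the terms E_0, ..., E_K. *)
have Hq : \sum_(k < K) q k <= D * \sum_(k < K.+1) E k + K.+1%:R * (ct * a * D ^+ 2).
  rewrite big_split/= -mulr_sumr lerD//.
    rewrite ler_wpM2l// big_ord_recl/= lerDr.
    exact: l1norm_ge0.
  rewrite sumr_const card_ord -[leLHS]mulr_natl ler_wpM2r//.
    by rewrite !mulr_ge0 ?sqr_ge0.
  by rewrite ler_nat.
have {}Hq := ler_wpM2l a0 Hq.
have Hp : a * \sum_(k < K.+1) e k <=
    a * \sum_(k < K.+1) p k + a * \sum_(k < K.+1) l1norm (s k).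
  rewrite -mulrDr ler_wpM2l// -big_split/=; apply: ler_sum => k _.
  by rewrite /e -{1}(subrK (s k) (z k - _)) l1normD.
rewrite mulrDr in Hq.
have E1 : a * (D * \sum_(k < K.+1) E k) = D * (a * \sum_(k < K.+1) E k) by ring.
have E2 : a * (K.+1%:R * (ct * a * D ^+ 2)) = ct * D ^+ 2 * (K.+1%:R * a ^+ 2) by ring.
rewrite E1 E2 in Hq; lra.
Qed.

(** The Jacobian error is charged with weight D in the descent and again with weight D through the
    function tracker, hence 2 D. The curvature term comes once from the descent and, through the
    factor 2 |LF|, twice from the function tracker, hence 3. *)
Lemma gap_sum_le K :
  a * \sum_(k < K.+1) fw_gap X F f Jf (y k) <=
    F (f (y 0%N)) (y 0%N) - fmin
    + 2 * `|LF| * (e 0%N + 2 * D * E 0%N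
       + a * \sum_(k < K.+1) (l1norm (s k) + 2 * D * l1norm (S k)))
    + 3 * `|LF| * ct * D ^+ 2 * (K.+1%:R * a ^+ 2).
Proof.
have D0 : 0 <= D by exact: le_trans (l1norm_ge0 _) (X_bounded y0_in y0_in).
have H N : a * \sum_(k < N) fw_gap X F f Jf (y k) <=
    F (f (y 0%N)) (y 0%N) - F (f (y N)) (y N)
    + 2 * `|LF| * (a * \sum_(k < N) (e k + E k * D))
    + `|LF| * ct * D ^+ 2 * (N%:R * a ^+ 2).
  elim: N => [|N IH]; first by rewrite !big_ord0 !(mulr0, mul0r) subrr !addr0.
  have := descent a0 a1 (iterate_in N) (run_x N) (run_y N) => Hd.
  rewrite !big_ord_recr/= !(mulrDr a) -natr1 mulrDl mul1r.
  move: IH Hd; rewrite -/(e N) -/(E N).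
  set B := fw_gap _ _ _ _ _; set C := \sum_(_ < _) _; set C' := \sum_(_ < _) _.
  rewrite !mulrDr; lra.
have := H K.+1; have := fminE (iterate_in K.+1).
have -> : a * \sum_(k < K.+1) (e k + E k * D) =
    a * \sum_(k < K.+1) e k + D * (a * \sum_(k < K.+1) E k).
  by rewrite big_split/= -mulr_suml; ring.
have -> : a * \sum_(k < K.+1) (l1norm (s k) + 2 * D * l1norm (S k)) =
    a * \sum_(k < K.+1) l1norm (s k) + 2 * D * (a * \sum_(k < K.+1) l1norm (S k)).
  by rewrite big_split/= -mulr_sumr; ring.
have h1 := function_tracking K.
have h2 := ler_wpM2l D0 (jacobian_tracking K).
set A1 := a * \sum_(k < K.+1) e k in h1 *.
set A2 := a * \sum_(k < K.+1) E k in h1 h2 *.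
set A3 := a * _ in h1 *.
set A4 := a * _ in h2 *.
set Q := K.+1%:R * _ in h1 *.
move=> h3 h4.
have h5 : A1 + D * A2 <= e 0%N + 2 * D * E 0%N + (A3 + 2 * D * A4) + ct * D ^+ 2 * Q.
  lra.
have := ler_wpM2l (normr_ge0 LF) h5; lra.
Qed.

End run.
End frank_wolfe.

(** * Moments of the oracle noise *)

Lemma measurable_rsum {R : realType} {dT} {T : measurableType dT} (I : Type)
    (s : seq I) (h : I -> T -> R) : (forall i, measurable_fun setT (h i)) ->
  measurable_fun setT (fun w => \sum_(i <- s) h i w).
Proof.
move=> mh; elim: s => [|i s IH].
  by under eq_fun do rewrite big_nil; exact: measurable_cst.
under eq_fun do rewrite big_cons.
exact: measurable_funD.
Qed.

Lemma measurable_enorm {R : realType} {dT} {T : measurableType dT} {m n : nat}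
    (A : T -> 'M[R]_(m, n)) : (forall i j, measurable_fun setT (fun w => A w i j)) ->
  measurable_fun setT (fun w => enorm (A w)).
Proof.
move=> mA; rewrite (_ : (fun w => _) =
    (fun w => (\sum_(i < m) \sum_(j < n) A w i j ^+ 2) `^ 2^-1)).
  apply: (measurableT_comp (measurable_powR _)).
  apply: measurable_rsum => i; apply: measurable_rsum => j.
  exact: measurable_funX.
apply/funext => w; rewrite powR12_sqrt//.
by apply: sumr_ge0 => i _; apply: sumr_ge0 => j _; exact: sqr_ge0.
Qed.

Lemma entry_moment {R : realType} {dT} {T : measurableType dT} {m n : nat}
    (P : probability T R) (A : T -> 'M[R]_(m, n)) r c i j : 0 <= r ->
  (forall i j, measurable_fun setT (fun w => A w i j)) ->
  ('E_P[fun s => (enorm (A s) `^ r)%R] <= c)%E ->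
  (\int[P]_s (`|A s i j| `^ r)%:E <= c)%E.
Proof.
move=> r0 mA; rewrite unlock; apply: le_trans.
apply: ge0_le_integral => //.
- exact/measurable_EFinP/measurable_norm_powR.
- apply/measurable_EFinP; apply: (measurableT_comp (measurable_powR r)).
  exact: measurable_enorm.
- move=> s _; rewrite lee_fin ge0_ler_powR ?nnegrE ?enorm_ge0//.
  exact: entry_le_enorm.
Qed.

Section noise.
Context {R : realType} {d m n : nat} {dX : measure_display}
  {Xi : measurableType dX}.
Variables (mu : probability Xi R) (X : set 'cV[R]_d)
  (h : 'cV[R]_d -> Xi -> 'M[R]_(m, n)) (g : 'cV[R]_d -> 'M[R]_(m, n)) (r c : R).
Hypotheses (X_compact : compact X) (mh : measurable_oracle X h)
  (h_unbiased : unbiased_on mu X h g) (r1 : 1 < r) (r2 : r <= 2).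
Hypothesis h_noise : forall x, X x ->
  ('E_mu[fun s => (enorm (h x s - g x) `^ r)%R] <= c%:E)%E.

(** A section of the joint oracle, obtained as the oracle along a constant curve indexed by Xi,
    restricted to the diagonal of Xi * Xi. *)
Lemma measurable_oracle_at x i j : X x -> measurable_fun setT (fun s => h x s i j).
Proof.
move=> Xx.
have H : measurable_fun setT (fun p : Xi * Xi => h x p.2 i j).
  exact: (measurable_oracle_comp (y := fun=> x) X_compact mh).
have mss : @measurable_fun _ _ Xi (Xi * Xi)%type setT (fun s => (s, s)).
  exact: measurable_fun_pair.
exact: (measurableT_comp H mss).
Qed.

Lemma measurable_noise x i j : X x ->
  measurable_fun setT (fun s => h x s i j - g x i j).
Proof.
move=> Xx; apply: measurable_funB => //; exact: measurable_oracle_at.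
Qed.

Lemma noise_moment x i j : X x ->
  (\int[mu]_s (`|h x s i j - g x i j| `^ r)%:E <= c%:E)%E.
Proof.
move=> Xx; have r0 : 0 <= r := ltW (lt_trans ltr01 r1).
have mA k l : measurable_fun setT (fun s => (h x s - g x) k l).
  by under eq_fun do rewrite mxE [X in _ + X]mxE; exact: measurable_noise.
have := entry_moment i j r0 mA (h_noise Xx).
by under eq_integral do rewrite mxE [X in _ + X]mxE.
Qed.

Lemma noise_integrable x i j : X x ->
  mu.-integrable setT (fun s => (h x s i j - g x i j)%:E).
Proof.
move=> Xx; apply/integrableP; split; first exact/measurable_EFinP/measurable_noise.
apply: le_lt_trans
  (expected_norm_le r1 ltr01 (measurable_noise i j Xx) (noise_moment i j Xx)) _.
by rewrite ltry.
Qed.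

Lemma noise_centered x i j : X x ->
  (\int[mu]_s (h x s i j - g x i j)%:E = 0)%E.
Proof.
move=> Xx; have iN := noise_integrable i j Xx.
have ic : mu.-integrable setT (fun=> (g x i j)%:E : \bar R).
  exact: finite_measure_integrable_cst.
(* Unbiasedness gives the value of the integral of h x, but splitting the difference also takes its
   integrability; h x is the integrable noise plus a constant. *)
have ih : mu.-integrable setT (fun s => (h x s i j)%:E).
  have := integrableD measurableT iN ic; apply: eq_integrable => // s _ /=.
  by rewrite -EFinD subrK.
under eq_integral do rewrite EFinB.
rewrite (integralB measurableT ih ic) integral_cst//= probability_setT mule1.
by have := h_unbiased Xx i j; rewrite unlock => ->; rewrite subee.
Qed.

End noise.

Section storm_noise.
Context {R : realType} {d n : nat} {dX : measure_display}
  {Xi : measurableType dX}.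
Variables (mu : probability Xi R) (X : set 'cV[R]_d)
  (gt : 'cV[R]_d -> Xi -> 'M[R]_(n, d)) (Jf : 'cV[R]_d -> 'M[R]_(n, d))
  (L Lbar sigma_g r D : R).
Hypotheses (X_compact : compact X) (gt_measurable : measurable_oracle X gt)
  (gt_unbiased : unbiased_on mu X gt Jf) (r1 : 1 < r) (r2 : r <= 2) (D0 : 0 <= D)
  (Lbar_gt0 : 0 < Lbar).
Hypothesis Jf_lipschitz : forall x y, X x -> X y ->
  opnorm (Jf x - Jf y) <= L * enorm (x - y).
Hypothesis gt_noise : forall x, X x ->
  ('E_mu[fun s => (enorm (gt x s - Jf x) `^ r)%R] <= (sigma_g `^ r)%:E)%E.
Hypothesis gt_smooth : forall x y, X x -> X y ->
  ('E_mu[fun s => (enorm (gt x s - gt y s) `^ r)%R]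
     <= (Lbar `^ r * enorm (x - y) `^ r)%:E)%E.

(* The STORM correction makes the increment of size a, not of the size of the
   noise: the noise itself enters with weight a only, and the rest is a
   difference over one step, whose length is at most [a * D]. *)
Lemma storm_increment_moment a x y i j : 0 <= a -> a <= 1 -> X x -> X y ->
  l1norm (x - y) <= a * D ->
  (\int[mu]_s (`|(gt x s i j - Jf x i j) - (1 - a) * (gt y s i j - Jf y i j)|
      `^ r)%:E <=
   (a `^ r * (4 * sigma_g `^ r + 16 * ((Lbar * D) `^ r + (`|L| * D) `^ r)))%:E)%E.
Proof.
move=> a0 a1 Xx Xy xy; have r0 : 0 <= r := ltW (lt_trans ltr01 r1).
have mx := measurable_oracle_at X_compact gt_measurable i j Xx.
have my := measurable_oracle_at X_compact gt_measurable i j Xy.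
have exy : enorm (x - y) <= a * D by rewrite (le_trans (enorm_le_l1norm _)).
pose N s := gt x s i j - Jf x i j.
pose Q s := gt x s i j - gt y s i j.
pose q := Jf x i j - Jf y i j.
have mN : measurable_fun setT N.
  exact: (measurable_noise _ X_compact gt_measurable).
have mQ : measurable_fun setT Q by exact: measurable_funB.
have HN : (\int[mu]_s (`|N s| `^ r)%:E <= (sigma_g `^ r)%:E)%E.
  exact: (noise_moment X_compact gt_measurable r1 gt_noise).
have HQ : (\int[mu]_s (`|Q s| `^ r)%:E <= ((Lbar * D) `^ r * a `^ r)%:E)%E.
  have mA k l : measurable_fun setT (fun s => (gt x s - gt y s) k l).
    under eq_fun do rewrite mxE [X in _ + X]mxE.
    by apply: measurable_funB; exact: (measurable_oracle_at X_compact).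
  apply: (@le_trans _ _ (Lbar `^ r * enorm (x - y) `^ r)%:E).
    have := entry_moment i j r0 mA (gt_smooth Xx Xy).
    by under eq_integral do rewrite mxE [X in _ + X]mxE.
  rewrite lee_fin (powRM _ (ltW Lbar_gt0) D0) -mulrA ler_wpM2l ?powR_ge0//.
  by rewrite -powRM// ge0_ler_powR ?nnegrE ?enorm_ge0 ?mulr_ge0// mulrC.
have Hq : `|q| `^ r <= (`|L| * D) `^ r * a `^ r.
  rewrite -powRM ?mulr_ge0// ge0_ler_powR ?nnegrE ?mulr_ge0//.
  apply: (@le_trans _ _ (opnorm (Jf x - Jf y))).
    by have := entry_le_opnorm (Jf x - Jf y) i j; rewrite mxE [X in _ + X]mxE.
  rewrite (le_trans (Jf_lipschitz Xx Xy))//.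
  rewrite (le_trans (ler_wpM2r (enorm_ge0 _) (ler_norm L)))//.
  by rewrite -mulrA ler_wpM2l// mulrC.
have pw s : `|N s - (1 - a) * (gt y s i j - Jf y i j)| `^ r <=
    4 * a `^ r * `|N s| `^ r + (16 * `|Q s| `^ r + 16 * `|q| `^ r).
  (* The bound 4 is applied to a N against (1 - a)(Q - q), then again to Q against q: this gives 4
     on the noise and 16 on the differences. *)
  rewrite (_ : N s - _ = a * N s + (1 - a) * (Q s - q)); last first.
    by rewrite /N /Q /q; ring.
  rewrite (le_trans (powR_normD_le4 _ _ r1 r2))// mulrDr lerD//.
    by rewrite normrM powRM// (ger0_norm a0) mulrA.
  have h1 : `|(1 - a) * (Q s - q)| `^ r <= `|Q s - q| `^ r.
    rewrite ge0_ler_powR ?nnegrE// normrM ler_piMl// ger0_norm ?subr_ge0//.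
    by rewrite lerBlDr lerDl.
  have := powR_normD_le4 (Q s) (- q) r1 r2; rewrite normrN; lra.
have iN := integrableZl measurableT (4 * a `^ r) (integrable_norm_powR mN HN).
have iQ := integrableZl measurableT 16 (integrable_norm_powR mQ HQ).
have ic : mu.-integrable setT (fun=> (16 * `|q| `^ r)%:E : \bar R).
  exact: finite_measure_integrable_cst.
have iQc := integrableD measurableT iQ ic.
have := integralD measurableT iN iQc.
rewrite (integralD measurableT iQ ic) !integralZl//; last 2 first.
- exact: integrable_norm_powR HQ.
- exact: integrable_norm_powR HN.
rewrite integral_cst//= probability_setT mule1 => E.
apply: (@le_trans _ _ (\int[mu]_s ((4 * a `^ r)%:E * (`|N s| `^ r)%:E +
    (16%:E * (`|Q s| `^ r)%:E + (16 * `|q| `^ r)%:E)))%E).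
  apply: ge0_le_integral => //.
  - apply/measurable_EFinP/measurable_norm_powR/measurable_funB => //.
    apply: measurable_funM => //.
    exact: (measurable_noise _ X_compact gt_measurable).
  - exact: (measurable_int mu (integrableD measurableT iN iQc)).
  - by move=> s _; rewrite -!EFinM -!EFinD lee_fin; exact: pw.
rewrite E.
apply: (@le_trans _ _ ((4 * a `^ r)%:E * (sigma_g `^ r)%:E +
    (16%:E * ((Lbar * D) `^ r * a `^ r)%:E + (16 * ((`|L| * D) `^ r * a `^ r))%:E))%E).
  apply: leeD; first by rewrite lee_wpmul2l// lee_fin mulr_ge0 ?powR_ge0.
  apply: leeD; first by rewrite lee_wpmul2l// lee_fin.
  by rewrite lee_fin ler_wpM2l.
by rewrite -!EFinM -!EFinD lee_fin; lra.
Qed.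

End storm_noise.

(** * Bounds on expectations of nonnegative variables *)

Section expected_le.
Context {R : realType} {dT : measure_display} {T : measurableType dT}.
Variable P : probability T R.
Implicit Types (A B : T -> R) (b c : R).

(** Measurability and nonnegativity are bundled with the bound, so that bounds combine under sums
    and nonnegative multiples without separate integrability arguments. *)
Definition expected_le A c := [/\ measurable_fun setT A, forall w, 0 <= A w
  & (\int[P]_w (A w)%:E <= c%:E)%E].

Lemma expected_le_cst c : 0 <= c -> expected_le (fun=> c) c.
Proof. by move=> c0; split => //; rewrite integral_cst//= probability_setT mule1. Qed.

Lemma expected_leD A B b c : expected_le A b -> expected_le B c ->
  expected_le (fun w => A w + B w) (b + c).
Proof.
move=> [mA A0 Ab] [mB B0 Bc]; split; first exact: measurable_funD.
  by move=> w; rewrite addr_ge0.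
under eq_integral do rewrite EFinD.
rewrite ge0_integralD//.
- by rewrite EFinD leeD.
- by move=> w _; rewrite lee_fin.
- exact/measurable_EFinP.
- by move=> w _; rewrite lee_fin.
- exact/measurable_EFinP.
Qed.

Lemma expected_leZ A b c : 0 <= b -> expected_le A c ->
  expected_le (fun w => b * A w) (b * c).
Proof.
move=> b0 [mA A0 Ac]; split; first exact: measurable_funM.
  by move=> w; rewrite mulr_ge0.
under eq_integral do rewrite EFinM.
rewrite ge0_integralZl//.
- by rewrite EFinM lee_wpmul2l ?lee_fin.
- exact/measurable_EFinP.
- by move=> w _; rewrite lee_fin.
Qed.

Lemma expected_le_sum (I : Type) (s : seq I) (A : I -> T -> R) c :
  (forall i, expected_le (A i) c) ->
  expected_le (fun w => \sum_(i <- s) A i w) ((size s)%:R * c).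
Proof.
move=> HA; elim: s => [|i s IH].
  rewrite mul0r; under [fun w => _]eq_fun do rewrite big_nil.
  exact: expected_le_cst.
under [fun w => _]eq_fun do rewrite big_cons.
by rewrite /= -nat1r mulrDl mul1r; exact: expected_leD.
Qed.

Lemma expected_le_l1norm m n (A : T -> 'M[R]_(m, n)) c :
  (forall i j, measurable_fun setT (fun w => A w i j)) ->
  (forall i j, (\int[P]_w `|A w i j|%:E <= c%:E)%E) ->
  expected_le (fun w => l1norm (A w)) ((m * n)%:R * c).
Proof.
move=> mA Ac; rewrite natrM -mulrA.
have -> : m%:R = (size (index_enum 'I_m))%:R :> R.
  by rewrite /index_enum -enumT size_enum_ord.
have -> : n%:R = (size (index_enum 'I_n))%:R :> R.
  by rewrite /index_enum -enumT size_enum_ord.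
apply: (@expected_le_sum _ _ (fun i w => \sum_(j < n) `|A w i j|)) => i.
apply: (@expected_le_sum _ _ (fun j w => `|A w i j|)) => j.
by split => //; exact: measurableT_comp.
Qed.

Lemma le_expected A B c : measurable_fun setT A -> (forall w, 0 <= A w) ->
  (forall w, A w <= B w) -> expected_le B c -> (\int[P]_w (A w)%:E <= c%:E)%E.
Proof.
move=> mA A0 AB [mB _ Bc]; apply: le_trans Bc; apply: ge0_le_integral => //.
- by move=> w _; rewrite lee_fin.
- exact/measurable_EFinP.
- exact/measurable_EFinP.
- by move=> w _; rewrite lee_fin.
Qed.

End expected_le.

Lemma compact_l1norm_bounded {R : realType} {d : nat} (X : set 'cV[R]_d) :
  compact X -> exists D, forall x y, X x -> X y -> l1norm (x - y) <= D.
Proof.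
move=> /compact_bounded[M [_ HM]].
exists ((d * 1)%:R * (M + 1) + (d * 1)%:R * (M + 1)) => x y Xx Xy.
have H (u : 'cV[R]_d) : X u -> l1norm u <= (d * 1)%:R * (M + 1).
  move=> Xu; apply: l1norm_le_entries => i j.
  have := HM (M + 1); rewrite ltrDl => /(_ ltr01 u Xu)/=.
  apply: le_trans.
  rewrite [leRHS]mx_normrE.
  exact: (le_bigmax _ (fun ij : 'I_d * 'I_1 => `|u ij.1 ij.2|) (i, j)).
by rewrite (le_trans (l1normB _ _))// lerD// H.
Qed.

(** The sum starts at 0 and the minimum at 1, so the term k = 0 is dropped by nonnegativity. The
    value +oo of the minimum is excluded because a > 0 and K > 0 would make the left side of the
    hypothesis infinite. *)
Lemma min_le_mean {R : realType} (E : nat -> \bar R) (a C : R) K :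
  (forall k, (0 <= E k)%E) -> 0 < a -> (0 < K)%N ->
  (a%:E * \sum_(k < K.+1) E k <= C%:E)%E ->
  (`| \big[Order.min/+oo]_(1 <= k < K.+1) E k | <= (C / (a * K%:R))%:E)%E.
Proof.
move=> E0 a0 K0 HC; set M := \big[_/_]_(_ <= _ < _) _.
have M0 : (0 <= M)%E.
  by apply: (big_ind (fun m => 0 <= m)%E) => // u v u0 v0; rewrite le_min u0.
have ME (k : 'I_K) : (M <= E k.+1)%E.
  by apply: ge_bigmin_seq; rewrite // mem_index_iota/= ltnS.
have {}HC : (a%:E * \sum_(k < K) M <= C%:E)%E.
  apply: le_trans HC; rewrite lee_wpmul2l ?lee_fin ?(ltW a0)//.
  rewrite big_ord_recl/= -[leLHS]add0e leeD//.
  by apply: lee_sum => k _; exact: ME.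
rewrite gee0_abs//; move: M M0 HC {ME} => [m| |]// m0 HC.
  have aK : 0 < a * K%:R by rewrite mulr_gt0// ltr0n.
  rewrite lee_fin ler_pdivlMr//.
  move: HC; rewrite sumEFin sumr_const card_ord -EFinM lee_fin -[_ *+ K]mulr_natl.
  by rewrite mulrA mulrC.
move: HC; case: K K0 => // K _.
have S0 : (0 <= \sum_(k < K) +oo :> \bar R)%E.
  by apply: sume_ge0 => k _; rewrite leey.
rewrite big_ord_recl/= addye; last by apply: contraTneq S0 => ->.
by rewrite gt0_muley.
Qed.

(** * Exponents of the step size and of the rate *)

Section rates.
Context {R : realType}.
Variables (r kappa : R).
Hypotheses (r1 : 1 < r) (kappa1 : 1 <= kappa).

Let a := kappa `^ (- r / (2 * r - 1)).
Let tau := kappa `^ (- (r - 1) / (2 * r - 1)).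

Let den_gt0 : 0 < 2 * r - 1.
Proof. by rewrite subr_gt0; have := r1; lra. Qed.

Let kappa_gt0 : 0 < kappa. Proof. exact: lt_le_trans kappa1. Qed.

Lemma stepsize_le1 : a <= 1.
Proof.
rewrite -[leRHS](powRr0 kappa) ler_powR// mulNr oppr_le0 divr_ge0 ?ltW//.
exact: lt_trans r1.
Qed.

Lemma stepsize_le_rate : a <= tau.
Proof. by rewrite ler_powR// ler_pM2r ?invr_gt0// lerN2 gerBl. Qed.

(** This is tau = a^((r-1)/r) in multiplied form: an increment moment a^r divided by the leak a is
    tau^r. *)
Lemma stepsize_powR : a `^ r = a * tau `^ r.
Proof.
rewrite -!powRrM -powRD; last by rewrite (gt_eqF kappa_gt0) implybT.
by congr powR; field; rewrite gt_eqF.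
Qed.

Lemma stepsize_rate : a * kappa * tau = 1.
Proof.
rewrite -[X in a * X]powRr1 ?(ltW kappa_gt0)//.
rewrite -!powRD ?(gt_eqF kappa_gt0) ?implybT//.
rewrite -[RHS](powRr0 kappa); congr powR; field.
by rewrite gt_eqF.
Qed.

End rates.

(** * The stochastic run and its martingales *)

(** The solution of S_{k+1} = q S_k + h_k, as a fixpoint so that the recursions asked by
    [gap_sum_le] hold by conversion. It starts at 0: the noise of the first sample, of order 1 and
    not a, is left to the contracting part. *)
Fixpoint leaky_sum {R : realType} {V : lmodType R} (q : R) (h : nat -> V) k : V :=
  if k is k'.+1 then q *: leaky_sum q h k' + h k' else 0.

Section storm.
Context {R : realType} {d n : nat} {dX : measure_display}
  {Xi : measurableType dX}.
Variables (mu : probability Xi R)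
  (X : set 'cV[R]_d) (F : 'cV[R]_n -> 'cV[R]_d -> R)
  (f : 'cV[R]_d -> 'cV[R]_n) (Jf : 'cV[R]_d -> 'M[R]_(n, d))
  (ft : 'cV[R]_d -> Xi -> 'cV[R]_n) (gt : 'cV[R]_d -> Xi -> 'M[R]_(n, d))
  (LF L Lbar sigma_f sigma_g r D fmin : R) (y0 : 'cV[R]_d).
Hypotheses (X_convex : convex_set X) (X_compact : compact X)
  (F_convex : convex_function (setT `*` X)
     (fun p : 'cV[R]_n * 'cV[R]_d => F p.1 p.2))
  (F_lipschitz : forall x (u v : 'cV[R]_n), X x ->
     `|F u x - F v x| <= LF * enorm (u - v))
  (f_jacobian : has_jacobian_on X f Jf)
  (Jf_lipschitz : forall x y, X x -> X y ->
     opnorm (Jf x - Jf y) <= L * enorm (x - y))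
  (gap_attained : forall y, X y ->
     exists x, is_argmin X (linearized F (f y) (Jf y) y) x)
  (fminE : forall x, X x -> fmin <= F (f x) x)
  (r_gt1 : 1 < r) (r_le2 : r <= 2)
  (ft_measurable : measurable_oracle X ft)
  (gt_measurable : measurable_oracle X gt)
  (ft_unbiased : unbiased_on mu X ft f)
  (gt_unbiased : unbiased_on mu X gt Jf)
  (ft_noise : forall x, X x ->
     ('E_mu[fun s => (enorm (ft x s - f x) `^ r)%R]
        <= (sigma_f `^ r)%:E)%E)
  (gt_noise : forall x, X x ->
     ('E_mu[fun s => (enorm (gt x s - Jf x) `^ r)%R]
        <= (sigma_g `^ r)%:E)%E)
  (Lbar_gt0 : 0 < Lbar)
  (gt_smooth : forall x y, X x -> X y ->
     ('E_mu[fun s => (enorm (gt x s - gt y s) `^ r)%R]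
        <= (Lbar `^ r * enorm (x - y) `^ r)%:E)%E)
  (y0_in : X y0)
  (X_bounded : forall x y, X x -> X y -> l1norm (x - y) <= D).

Let D0 : 0 <= D.
Proof. exact: le_trans (l1norm_ge0 _) (X_bounded y0_in y0_in). Qed.

Let cg := 4 * sigma_g `^ r + 16 * ((Lbar * D) `^ r + (`|L| * D) `^ r).

Section one_run.
Context {dT : measure_display} {T : measurableType dT}.
Variables (P : probability T R) (a tau : R)
  (xi : nat -> T -> Xi) (G : nat -> set (set T))
  (x y : nat -> T -> 'cV[R]_d) (z : nat -> T -> 'cV[R]_n)
  (V : nat -> T -> 'M[R]_(n, d)).
Hypothesis run : storm_run P mu X F ft gt a a a y0 xi G x y z V.
Hypotheses (a0 : 0 < a) (a1 : a <= 1) (tau0 : 0 < tau)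
  (a_tau : a `^ r = a * tau `^ r).

Local Notation sub k := (g_sigma_algebraType (G k)).

Let samples := run_samples run.
Let nonant := run_nonanticipating run.

Lemma run_in k w : X (y k w).
Proof.
elim: k => [|k IH]; first by rewrite (run_y0 run).
rewrite (run_y run); apply: convex_comb_in => //; first exact: ltW.
by have [] := run_x run k w.
Qed.

Let measurable_x k i : measurable_fun setT ((fun w => x k.+1 w i 0) : sub k -> R).
Proof.
have [_ _ _ Gx] := nonant.
move=> _ B mB; rewrite setTI (sub_measurableE nonant); exact: Gx.
Qed.

(** y_{k+1} is already determined at time k, as x_{k+1} is chosen before the sample k + 1 is seen.
    That sample is therefore fresh for the oracle at y_{k+1} as well as at y_k. *)
Let measurable_yS k i : measurable_fun setT ((fun w => y k.+1 w i 0) : sub k -> R).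
Proof.
elim: k => [|k IH].
  under eq_fun do rewrite (run_y run) mxE entryZ entryZ (run_y0 run).
  by apply: measurable_funD => //; apply: measurable_funM.
under eq_fun do rewrite (run_y run) mxE entryZ entryZ.
apply: measurable_funD; apply: measurable_funM => //.
exact: (sub_measurable_funS nonant IH).
Qed.

Let measurable_y k i : measurable_fun setT ((fun w => y k w i 0) : sub k -> R).
Proof.
case: k => [|k]; last exact: (sub_measurable_funS nonant (@measurable_yS k i)).
under eq_fun do rewrite (run_y0 run). exact: measurable_cst.
Qed.

Let measurable_noise_along {m p : nat} (h : 'cV[R]_d -> Xi -> 'M[R]_(m, p))
    (g : 'cV[R]_d -> 'M[R]_(m, p)) k (u : T -> 'cV[R]_d) i j :
  measurable_oracle X h -> unbiased_on mu X h g -> (forall w, X (u w)) ->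
  (forall l, measurable_fun setT ((fun w => u w l 0) : sub k -> R)) ->
  measurable_fun setT (fun p : sub k * Xi => h (u p.1) p.2 i j - g (u p.1) i j).
Proof.
move=> mh ub uX mu_; apply: measurable_funB.
  exact: (measurable_oracle_comp (T := sub k) X_compact mh).
have mg := measurable_oracle_mean (T := sub k) X_compact mh i j ub mu_ uX.
exact: (measurableT_comp mg).
Qed.

Definition jacobian_martingale k w : 'M[R]_(n, d) :=
  leaky_sum (1 - a) (fun k => (gt (y k.+1 w) (xi k.+1 w) - Jf (y k.+1 w))
    - (1 - a) *: (gt (y k w) (xi k.+1 w) - Jf (y k w))) k.

Definition function_martingale k w : 'cV[R]_n :=
  leaky_sum (1 - a) (fun k =>
    a *: (ft (y k.+1 w) (xi k.+1 w) - f (y k.+1 w))) k.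

Let q0 : 0 <= 1 - a. Proof. by rewrite subr_ge0. Qed.
Let q1 : 1 - a < 1. Proof. by rewrite ltrBlDr ltrDl. Qed.

(** The hypothesis is the output of [martingale_moment] for q = 1 - a and m = a^r c, namely 6 c
    tau^r; the threshold tau then gives tau + 6 c tau^(1-r) tau^r. *)
Let moment_to_mean (A : T -> R) c : measurable_fun setT A ->
  (\int[P]_w (`|A w| `^ r)%:E <= (6 * (a `^ r * c) / (1 - (1 - a)))%:E)%E ->
  (\int[P]_w `|A w|%:E <= ((1 + 6 * c) * tau)%:E)%E.
Proof.
move=> mA HA; apply: (le_trans (expected_norm_le r_gt1 tau0 mA HA)).
rewrite lee_fin opprB addrCA subrr addr0 a_tau.
rewrite le_eqVlt; apply/orP; left; apply/eqP.
have E : tau `^ (1 - r) * tau `^ r = tau.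
  by rewrite -powRD ?subrK ?powRr1 ?(ltW tau0)// gt_eqF ?implybT.
move: (tau `^ (1 - r)) (tau `^ r) E => t1 t2 E.
have -> : t1 * (6 * (a * t2 * c) / a) = 6 * c * (t1 * t2).
  by field; rewrite gt_eqF.
by rewrite E; ring.
Qed.

(** The sample is a separate argument, to be integrated out while the past w stays fixed. *)
Let jacobian_increment k w s i j : R := (gt (y k.+1 w) s i j - Jf (y k.+1 w) i j)
  - (1 - a) * (gt (y k w) s i j - Jf (y k w) i j).

Let measurable_jacobian_increment k i j : measurable_fun setT
  (fun p : sub k * Xi => jacobian_increment k p.1 p.2 i j).
Proof.
apply: measurable_funB; last apply: measurable_funM => //.
  exact: (measurable_noise_along i j gt_measurable gt_unbiased (run_in k.+1)
    (@measurable_yS k)).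
exact: (measurable_noise_along i j gt_measurable gt_unbiased (run_in k)
  (@measurable_y k)).
Qed.

Let jacobian_increment_centered k w i j :
  (\int[mu]_s (jacobian_increment k w s i j)%:E = 0)%E.
Proof.
have i1 := noise_integrable X_compact gt_measurable r_gt1 gt_noise i j (run_in k.+1 w).
have i2 := noise_integrable X_compact gt_measurable r_gt1 gt_noise i j (run_in k w).
have i3 := integrableZl measurableT (1 - a) i2.
have := integralB measurableT i1 i3.
rewrite integralZl// !(noise_centered X_compact gt_measurable gt_unbiased r_gt1
  gt_noise _ _ (run_in _ w)).
by rewrite mule0 sube0.
Qed.

Let jacobian_increment_moment k w i j :
  (\int[mu]_s (`|jacobian_increment k w s i j| `^ r)%:E <= (a `^ r * cg)%:E)%E.
Proof.
apply: (storm_increment_moment X_compact gt_measurable) => //.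
- exact: ltW.
- exact: run_in.
- exact: run_in.
- have -> : y k.+1 w - y k w = a *: (x k.+1 w - y k w).
    by rewrite (run_y run); apply/matrixP => k1 k2; rewrite !mxE; ring.
  rewrite l1normZ gtr0_norm// ler_wpM2l ?(ltW a0)// X_bounded//; last exact: run_in.
  by have [] := run_x run k w.
Qed.

Lemma jacobian_martingale_mean k :
  expected_le P (fun w => l1norm (jacobian_martingale k w))
    ((n * d)%:R * ((1 + 6 * cg) * tau)).
Proof.
have S0 i j w : jacobian_martingale 0 w i j = 0 by rewrite /= mxE.
have SS i j k' w : jacobian_martingale k'.+1 w i j =
    (1 - a) * jacobian_martingale k' w i j + jacobian_increment k' w (xi k'.+1 w) i j.
  rewrite /jacobian_martingale/= mxE entryZ entryBB entryZ.
  by rewrite -/(jacobian_martingale _ _) /jacobian_increment !mxE; ring.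
have mS i j : measurable_fun setT (fun w => jacobian_martingale k w i j).
  apply: (sub_measurable_fun nonant (k := k)).
  apply: (martingale_measurable nonant (h := fun k w s => jacobian_increment k w s i j)
    (S := fun k w => jacobian_martingale k w i j)).
  - by move=> k'; exact: measurable_jacobian_increment.
  - exact: S0.
  - exact: SS.
apply: expected_le_l1norm => // i j; apply: moment_to_mean => //.
apply: (martingale_moment samples nonant (h := fun k w s => jacobian_increment k w s i j)
    (S := fun k w => jacobian_martingale k w i j)) => //.
Qed.

Let function_increment k w s i : R := a * (ft (y k.+1 w) s i 0 - f (y k.+1 w) i 0).

Let measurable_function_increment k i : measurable_fun setT
  (fun p : sub k * Xi => function_increment k p.1 p.2 i).
Proof.
apply: measurable_funM => //.
exact: (measurable_noise_along i 0 ft_measurable ft_unbiased (run_in k.+1)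
  (@measurable_yS k)).
Qed.

Let function_increment_moment k w i :
  (\int[mu]_s (`|function_increment k w s i| `^ r)%:E <= (a `^ r * sigma_f `^ r)%:E)%E.
Proof.
have mN := measurable_noise (m := n) f X_compact ft_measurable i 0 (run_in k.+1 w).
under eq_integral do rewrite normrM powRM// (gtr0_norm a0) EFinM.
rewrite ge0_integralZl//.
- rewrite EFinM lee_wpmul2l ?lee_fin ?powR_ge0//.
  exact: (noise_moment X_compact ft_measurable r_gt1 ft_noise _ _ (run_in _ w)).
- exact/measurable_EFinP/measurable_norm_powR.
- by rewrite lee_fin powR_ge0.
Qed.

Lemma function_martingale_mean k :
  expected_le P (fun w => l1norm (function_martingale k w))
    ((n * 1)%:R * ((1 + 6 * sigma_f `^ r) * tau)).
Proof.
have S0 i w : function_martingale 0 w i 0 = 0 by rewrite /= mxE.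
have SS i k' w : function_martingale k'.+1 w i 0 =
    (1 - a) * function_martingale k' w i 0 + function_increment k' w (xi k'.+1 w) i.
  by rewrite /function_martingale/= mxE !entryZ /function_increment !mxE.
have mS i : measurable_fun setT (fun w => function_martingale k w i 0).
  apply: (sub_measurable_fun nonant (k := k)).
  apply: (martingale_measurable nonant (h := fun k w s => function_increment k w s i)
    (S := fun k w => function_martingale k w i 0)).
  - by move=> k'; exact: measurable_function_increment.
  - exact: S0.
  - exact: SS.
apply: expected_le_l1norm => [i j|i j]; rewrite ?(ord1 j)//.
apply: moment_to_mean => //.
apply: (martingale_moment samples nonant (h := fun k w s => function_increment k w s i)
    (S := fun k w => function_martingale k w i 0)) => //.
move=> k' w; have i1 := noise_integrable X_compact ft_measurable r_gt1 ft_noise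
  i 0 (run_in k'.+1 w).
under eq_integral do rewrite EFinM.
rewrite integralZl// (noise_centered X_compact ft_measurable ft_unbiased r_gt1
  ft_noise _ _ (run_in _ w)).
by rewrite mule0.
Qed.

(** y_0 is deterministic, so the noise moment is transported along the law of the first sample; the
    threshold is 1, no smallness being available here. *)
Lemma initial_error_mean {m p : nat} (h : 'cV[R]_d -> Xi -> 'M[R]_(m, p))
    (g : 'cV[R]_d -> 'M[R]_(m, p)) c : measurable_oracle X h ->
  (forall u, X u -> ('E_mu[fun s => (enorm (h u s - g u) `^ r)%R] <= c%:E)%E) ->
  expected_le P (fun w => l1norm (h (y 0%N w) (xi 0%N w) - g (y 0%N w)))
    ((m * p)%:R * (1 + c)).
Proof.
move=> mh hn; have [mxi law _] := samples.
have mN i j := measurable_noise g X_compact mh i j y0_in.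
have E i j w : (h (y 0%N w) (xi 0%N w) - g (y 0%N w)) i j =
    h y0 (xi 0%N w) i j - g y0 i j by rewrite (run_y0 run) !mxE.
apply: expected_le_l1norm => i j.
  under eq_fun do rewrite E.
  exact: (measurableT_comp (mN i j) (mxi 0%N)).
under eq_integral do rewrite E.
have := expected_norm_le r_gt1 ltr01 (mN i j)
  (noise_moment X_compact mh r_gt1 hn i j y0_in).
rewrite powR1 mul1r; apply: le_trans.
pose xi0 : {mfun T >-> Xi} := mfun_Sub (mem_set (mxi 0%N)).
have -> : (\int[mu]_s `|h y0 s i j - g y0 i j|%:E =
    \int[distribution P xi0]_s `|h y0 s i j - g y0 i j|%:E)%E.
  by apply: eq_measure_integral => A mA _; exact: (esym (law 0%N A mA)).
rewrite ge0_integral_distribution//.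
by apply/measurable_EFinP; exact: measurableT_comp (mN i j).
Qed.

Let ct := n%:R * ((n * d)%:R * `|L|).

(** The pathwise bound [W] involves only constants, the two initial errors and the two martingales,
    so it is integrated term by term. *)
Lemma expected_gap_sum K :
  (forall k, measurable_fun setT (fun w => fw_gap X F f Jf (y k w))) ->
  (\int[P]_w (a * \sum_(k < K.+1) fw_gap X F f Jf (y k w))%:E <=
    (F (f y0) y0 - fmin + 3 * `|LF| * ct * D ^+ 2 * (K.+1%:R * a ^+ 2)
     + 2 * `|LF| * ((n * 1)%:R * (1 + sigma_f `^ r)
        + 2 * D * ((n * d)%:R * (1 + sigma_g `^ r))
        + a * (K.+1%:R * ((n * 1)%:R * ((1 + 6 * sigma_f `^ r) * tau)
            + 2 * D * ((n * d)%:R * ((1 + 6 * cg) * tau))))))%:E)%E.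
Proof.
move=> mgap.
pose W w := F (f y0) y0 - fmin + 3 * `|LF| * ct * D ^+ 2 * (K.+1%:R * a ^+ 2)
  + 2 * `|LF| * (l1norm (ft (y 0%N w) (xi 0%N w) - f (y 0%N w))
     + 2 * D * l1norm (gt (y 0%N w) (xi 0%N w) - Jf (y 0%N w))
     + a * \sum_(k < K.+1) (l1norm (function_martingale k w)
         + 2 * D * l1norm (jacobian_martingale k w))).
have ct0 : 0 <= ct by rewrite !mulr_ge0.
have D20 : 0 <= 2 * D by rewrite mulr_ge0.
apply: (@le_expected _ _ _ P _ W).
- by apply: measurable_funM => //; apply: measurable_rsum => k; exact: mgap.
- move=> w; rewrite mulr_ge0 ?(ltW a0)//; apply: sumr_ge0 => k _.
  exact: (fw_gap_ge0 gap_attained (run_in _ w)).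
- move=> w.
  have := @gap_sum_le R d n X F f Jf LF L D X_convex F_convex F_lipschitz
    f_jacobian Jf_lipschitz gap_attained X_bounded a fmin
    (x^~ w) (y^~ w) (z^~ w) (fun k => ft (y k.+1 w) (xi k.+1 w))
    (function_martingale^~ w) (V^~ w) (jacobian_martingale^~ w)
    (fun k => gt (y k.+1 w) (xi k.+1 w)) (fun k => gt (y k w) (xi k.+1 w))
    (ltW a0) a1 (run_in 0%N w) fminE
    (fun k => run_V run k w) (fun k => run_z run k w) (fun k => run_x run k w)
    (fun k => run_y run k w) erefl erefl (fun k => erefl) (fun k => erefl) K.
  rewrite /W (run_z0 run) (run_V0 run) (run_y0 run) -/ct; lra.
- apply: expected_leD.
    apply: expected_le_cst.
    apply: addr_ge0; first by rewrite subr_ge0 fminE.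
    apply: mulr_ge0; last by rewrite mulr_ge0 ?sqr_ge0.
    apply: mulr_ge0; last exact: sqr_ge0.
    by rewrite !mulr_ge0.
  apply: expected_leZ; first by rewrite mulr_ge0.
  apply: expected_leD; first apply: expected_leD.
  + exact: initial_error_mean.
  + by apply: expected_leZ => //; exact: initial_error_mean.
  apply: expected_leZ; first exact: ltW.
  have -> : K.+1%:R = (size (index_enum 'I_K.+1))%:R :> R.
    by rewrite /index_enum -enumT size_enum_ord.
  apply: (@expected_le_sum _ _ _ P _ _ (fun (k : 'I_K.+1) w => l1norm (function_martingale k w)
    + 2 * D * l1norm (jacobian_martingale k w))) => k.
  apply: expected_leD; first exact: function_martingale_mean.
  by apply: expected_leZ => //; exact: jacobian_martingale_mean.
Qed.

End one_run.
End storm.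

(** * Choice of the constant and conclusion *)

Theorem theorem3 (R : realType) (d n : nat)
    (dX : measure_display) (Xi : measurableType dX) (mu : probability Xi R)
    (X : set 'cV[R]_d) (F : 'cV[R]_n -> 'cV[R]_d -> R)
    (f : 'cV[R]_d -> 'cV[R]_n) (Jf : 'cV[R]_d -> 'M[R]_(n, d))
    (ft : 'cV[R]_d -> Xi -> 'cV[R]_n) (gt : 'cV[R]_d -> Xi -> 'M[R]_(n, d))
    (LF L Lbar sigma_f sigma_g r : R) (y0 : 'cV[R]_d)
    (* feasible set *)
    (X_convex : convex_set X) (X_compact : compact X)
    (* outer function; joint convexity cannot be dispensed with, witness
       F u x = (x != 0) *)
    (F_convex : convex_function (setT `*` X)
       (fun p : 'cV[R]_n * 'cV[R]_d => F p.1 p.2))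
    (F_lipschitz : forall x (u v : 'cV[R]_n), X x ->
       `|F u x - F v x| <= LF * enorm (u - v))
    (F_monotone : forall x (u v : 'cV[R]_n), X x ->
       (forall i, u i 0 <= v i 0) -> F u x <= F v x)
    (F_subhomogeneous : forall x (u : 'cV[R]_n) c, X x -> 1 <= c ->
       F (c *: u) x <= c * F u x)
    (* inner function *)
    (f_jacobian : has_jacobian_on X f Jf)
    (Jf_lipschitz : forall x y, X x -> X y ->
       opnorm (Jf x - Jf y) <= L * enorm (x - y))
    (* attainment of the minima *)
    (phi_attained : exists x, is_argmin X (fun x => F (f x) x) x)
    (gap_attained : forall y, X y ->
       exists x, is_argmin X (linearized F (f y) (Jf y) y) x)
    (* stochastic oracle *)
    (r_gt1 : 1 < r) (r_le2 : r <= 2)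
    (sigma_f_ge0 : 0 <= sigma_f) (sigma_g_ge0 : 0 <= sigma_g)
    (ft_measurable : measurable_oracle X ft)
    (gt_measurable : measurable_oracle X gt)
    (ft_unbiased : unbiased_on mu X ft f)
    (gt_unbiased : unbiased_on mu X gt Jf)
    (ft_noise : forall x, X x ->
       ('E_mu[fun s => (enorm (ft x s - f x) `^ r)%R]
          <= (sigma_f `^ r)%:E)%E)
    (gt_noise : forall x, X x ->
       ('E_mu[fun s => (enorm (gt x s - Jf x) `^ r)%R]
          <= (sigma_g `^ r)%:E)%E)
    (* average smoothness *)
    (Lbar_gt0 : 0 < Lbar)
    (gt_smooth : forall x y, X x -> X y ->
       ('E_mu[fun s => (enorm (gt x s - gt y s) `^ r)%R]
          <= (Lbar `^ r * enorm (x - y) `^ r)%:E)%E)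
    (y0_in : X y0) :
  storm_gap_rate mu X F f Jf ft gt y0 r (- (r - 1) / (2 * r - 1)) /\
  (r = 2 -> storm_gap_rate mu X F f Jf ft gt y0 r (- 1 / 3)).
Proof.
have [D X_bounded] := compact_l1norm_bounded X_compact.
have [xm [_ xmin]] := phi_attained.
suff rate : storm_gap_rate mu X F f Jf ft gt y0 r (- (r - 1) / (2 * r - 1)).
  split=> // r_eq2; rewrite (_ : - 1 / 3 = - (r - 1) / (2 * r - 1))//.
  by rewrite r_eq2; field.
pose fmin := F (f xm) xm.
pose ct : R := n%:R * ((n * d)%:R * `|L|).
pose cg := 4 * sigma_g `^ r + 16 * ((Lbar * D) `^ r + (`|L| * D) `^ r).
pose c0 := F (f y0) y0 - fmin.
pose c1 := 3 * `|LF| * ct * D ^+ 2.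
pose c2 := (n * 1)%:R * (1 + sigma_f `^ r) + 2 * D * ((n * d)%:R * (1 + sigma_g `^ r)).
pose c3 := (n * 1)%:R * (1 + 6 * sigma_f `^ r) + 2 * D * ((n * d)%:R * (1 + 6 * cg)).
(* The constant is fixed before K and the run. The factors 2 on c1 and c3 bound (K + 1) a^2 and (K +
   1) a tau, from K = 1 on. *)
exists (c0 + c1 * 2 + 2 * `|LF| * (c2 + 2 * c3)), 1%N => // K /= K1.
set a := K%:R `^ (- r / (2 * r - 1)); set tau := K%:R `^ (- (r - 1) / (2 * r - 1)).
move=> dT T P xi G x y z V run mgap.
have K1' : 1 <= K%:R :> R by rewrite ler1n.
have K_gt0 : 0 < K%:R :> R by rewrite ltr0n.
have a0 : 0 < a by rewrite powR_gt0.
have tau0 : 0 < tau by rewrite powR_gt0.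
have a1 : a <= 1 := stepsize_le1 r_gt1 K1'.
have a_tau : a <= tau := stepsize_le_rate r_gt1 K1'.
have aKtau : a * K%:R * tau = 1 := stepsize_rate r_gt1 K1'.
have D0 : 0 <= D by exact: le_trans (l1norm_ge0 _) (X_bounded _ _ y0_in y0_in).
have cg0 : 0 <= cg.
  by apply: addr_ge0; rewrite mulr_ge0 ?addr_ge0 ?powR_ge0.
have ct0 : 0 <= ct by rewrite !mulr_ge0.
have c10 : 0 <= c1 by rewrite /c1 mulr_ge0 ?sqr_ge0// mulr_ge0// mulr_ge0.
have c30 : 0 <= c3.
  by rewrite addr_ge0// !mulr_ge0// addr_ge0// mulr_ge0// powR_ge0.
have H := @expected_gap_sum R d n dX Xi mu X F f Jf ft gt LF L Lbar sigma_f sigma_g r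
  D fmin y0 X_convex X_compact F_convex F_lipschitz f_jacobian Jf_lipschitz
  gap_attained xmin r_gt1 r_le2 ft_measurable gt_measurable ft_unbiased gt_unbiased
  ft_noise gt_noise Lbar_gt0 gt_smooth y0_in X_bounded dT T P a tau xi G x y z V
  run a0 a1 tau0 (stepsize_powR r_gt1 K1') K mgap.
have gap0 k w : 0 <= fw_gap X F f Jf (y k w).
  exact: (fw_gap_ge0 gap_attained (run_in X_convex y0_in run a0 a1 k w)).
set E := fun k => ('E_P[fun w => fw_gap X F f Jf (y k w)])%E.
have E0 k : (0 <= E k)%E by rewrite /E expectation_ge0.
have aE : (a%:E * \sum_(k < K.+1) E k <=
    (c0 + c1 * 2 + 2 * `|LF| * (c2 + 2 * c3))%:E)%E.
  have -> : (a%:E * \sum_(k < K.+1) E k =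
      \int[P]_w (a * \sum_(k < K.+1) fw_gap X F f Jf (y k w))%:E)%E.
    under [RHS]eq_integral do rewrite EFinM -sumEFin.
    rewrite ge0_integralZl ?lee_fin ?(ltW a0)//; last 2 first.
    - by apply: emeasurable_sum => k; exact/measurable_EFinP.
    - by move=> w _; apply: sume_ge0 => k _; rewrite lee_fin.
    congr (_ * _)%E; rewrite ge0_integral_sum//.
    - by apply: eq_bigr => k _; rewrite /E unlock.
    - by move=> k; exact/measurable_EFinP.
    - by move=> k w _; rewrite lee_fin.
  apply: le_trans H _; rewrite lee_fin -/c0 -/c1 -/c2.
  (* Here a K a <= a K tau = 1 because a <= tau; the extra index contributes a^2 <= a K a. *)
  have h1 : K.+1%:R * a ^+ 2 <= 2.
    have e1 : a * K%:R * a <= 1.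
      by rewrite -[leRHS]aKtau ler_wpM2l// mulr_ge0 ?(ltW a0) ?(ltW K_gt0).
    have e2 : a * a <= a * K%:R * a by rewrite ler_pM2r// ler_peMr// (ltW a0).
    rewrite -natr1 expr2; lra.
  have h2 : a * (K.+1%:R * tau) <= 2.
    have e1 : a * tau <= a * K%:R * tau by rewrite ler_pM2r// ler_peMr// (ltW a0).
    rewrite -natr1; lra.
  have h3 := ler_wpM2l c10 h1.
  have h4 := ler_wpM2l c30 h2.
  have h5 := ler_wpM2l (normr_ge0 LF) h4.
  rewrite -/ct -/cg -/c1 in h3 *.
  have -> : a * (K.+1%:R * ((n * 1)%:R * ((1 + 6 * sigma_f `^ r) * tau) +
      2 * D * ((n * d)%:R * ((1 + 6 * cg) * tau)))) = c3 * (a * (K.+1%:R * tau)).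
    by rewrite /c3; ring.
  lra.
apply: (le_trans (min_le_mean E0 a0 K1 aE)).
(* Dividing by a K is multiplying by tau, since a K tau = 1. *)
rewrite lee_fin -/tau le_eqVlt; apply/orP; left; apply/eqP; congr (_ * _).
have aK0 := lt0r_neq0 (mulr_gt0 a0 K_gt0).
by apply: (mulfI aK0); rewrite aKtau mulfV.
Qed.
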